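(* Let $f_n$ be the approximation ratio (on graphs with $n$ vertices) of some polynomial-time approximation algorithm for the Min-Ratio Vertex Cut Problem. Then there exists a polynomial-time $O(f_n)$-approximation algorithm for the Graph Search Problem, i.e. an algorithm which, given a connected graph $G$ with $n$ vertices and $c,w:V(G)\to\mathbb{N}$, outputs a decision tree $D$ for $G$ with $c_G(D)\le O(f_n)\cdot\texttt{OPT}(G)$, where $\texttt{OPT}(G)$ is the minimum cost of a decision tree for $G$.
   Context: Graphs are simple and connected. For a connected graph $G$ and $v\in V(G)$, $G-v$ denotes the set of connected components of the graph obtained by deleting $v$. A decision tree for a connected graph $G$ is a rooted tree $D$ with $V(D)=V(G)$ defined recursively: its root $r$ is a vertex of $G$, and for each connected component $H$ of $G-r$ there is exactly one child of $r$, which is the root of a decision tree for $H$ (these subtrees being all of $D-r$). For $x\in V(G)$, $Q_G(D,x)$ is the sequence of vertices on the path in $D$ from the root to $x$. Given $c,w:V(G)\to\mathbb{N}$, $c_G(D)=\sum_{x\in V(G)} w(x)\sum_{q\in Q_G(D,x)} c(q)$. The Graph Search Problem asks, given $(G,c,w)$, for a decision tree minimizing $c_G(D)$. For $X\subseteq V(G)$, $f(X)=\sum_{v\in X}f(v)$. The Min-Ratio Vertex Cut Problem: given a graph $G$ and $c,w:V(G)\to\mathbb{N}$, find a partition $(A,S,B)$ of $V(G)$ such that there is no edge $uv\in E(G)$ with $u\in A$, $v\in B$, minimizing $\frac{c(S)}{w(A\cup S)\cdot w(B\cup S)}$. An algorithm for it has approximation ratio $f_n$ if on every $n$-vertex instance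 it returns such a partition whose ratio is at most $f_n$ times the optimal ratio. *)

(* Defs.v *)
From HB Require Import structures.
From mathcomp Require Import all_boot all_order all_algebra.

Set Implicit Arguments.
Unset Strict Implicit.
Unset Printing Implicit Defensive.

Import Order.TTheory GRing.Theory Num.Theory.

(* Polynomial time is taken with respect to the following machine model:
   while-programs acting on one register that holds a binary tree
   (an S-expression over a single atom).  Every elementary step is charged the
   number of nodes of the tree it acts on, as if the tree were copied or erased
   cell by cell; without this charge, [pPair pId pId] iterated n times would
   build a tree of size 2^n in time O(n).  Hence a Turing machine simulates
   these programs with polynomial overhead; conversely a Turing machine
   configuration is a tree and one transition is a loop-free program, so that
   polynomial time here is the usual notion. *)

Inductive data := dnil | dcons of data & data.

Definition dhd (x : data) := if x is dcons a _ then a else dnil.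
Definition dtl (x : data) := if x is dcons _ b then b else dnil.

Fixpoint dsize (x : data) : nat :=
  if x is dcons a b then (dsize a + dsize b).+1 else 1.

Inductive prog :=
  | pId
  | pNil
  | pHd
  | pTl
  | pPair of prog & prog
  | pSeq of prog & prog
  | pIf of prog & prog
  | pWhile of prog.

(* [eval p x y t]: started with x in its register, p halts with y in it after
   time t.  [pIf] and [pWhile] test whether the head of the register is
   different from the atom. *)
Inductive eval : prog -> data -> data -> nat -> Prop :=
  | eval_id x : eval pId x x (dsize x)
  | eval_nil x : eval pNil x dnil (dsize x)
  | eval_hd x : eval pHd x (dhd x) (dsize x)
  | eval_tl x : eval pTl x (dtl x) (dsize x)
  | eval_pair p q x y z s t :
      eval p x y s -> eval q x z t ->
      eval (pPair p q) x (dcons y z) (dsize x + s + t)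
  | eval_seq p q x y z s t :
      eval p x y s -> eval q y z t -> eval (pSeq p q) x z (s + t)
  | eval_ift p q x y t :
      dhd x <> dnil -> eval p x y t -> eval (pIf p q) x y (dsize x + t)
  | eval_iff p q x y t :
      dhd x = dnil -> eval q x y t -> eval (pIf p q) x y (dsize x + t)
  | eval_while_stop p x :
      dhd x = dnil -> eval (pWhile p) x x (dsize x)
  | eval_while_step p x y z s t :
      dhd x <> dnil -> eval p x y s -> eval (pWhile p) y z t ->
      eval (pWhile p) x z (dsize x + s + t).

(* Since [0 < dsize x], every polynomial in the size of the input is bounded by
   some [a * dsize x ^ k]. *)
Definition polytime_solves (I : Type) (O : I -> Type)
    (encI : I -> data) (encO : forall i, O i -> data)
    (sol : forall i, O i -> Prop) (p : prog) : Prop :=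
  exists a k : nat, forall i : I, exists (o : O i) (t : nat),
    [/\ eval p (encI i) (encO i o) t, t <= a * dsize (encI i) ^ k & sol i o].

Definition enc_seq (s : seq data) : data := foldr dcons dnil s.

Definition enc_bool (b : bool) : data := if b then dcons dnil dnil else dnil.

(* Binary expansion, least significant bit first, without leading zeros. *)
Definition bits (m : nat) : seq bool :=
  mkseq (fun i => odd (m %/ 2 ^ i)) (up_log 2 m.+1).

Definition enc_nat (m : nat) : data := enc_seq (map enc_bool (bits m)).

(* Unary: the index of a vertex is at most the size of any encoding of its
   graph. *)
Definition enc_vertex (n : nat) (v : 'I_n) : data := iter v (dcons dnil) dnil.

Definition enc_set (n : nat) (X : {set 'I_n}) : data :=
  enc_seq [seq enc_bool (v \in X) | v <- enum 'I_n].

Record instance := Instance {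
  nvert : nat;
  edge : rel 'I_nvert;
  cost : 'I_nvert -> nat;
  weight : 'I_nvert -> nat;
  nvert_gt0 : 0 < nvert;
  edge_sym : symmetric edge;
  edge_irr : irreflexive edge;
  edge_conn : forall u v, connect edge u v
}.

(* Adjacency matrix, then costs and weights in binary. *)
Definition enc_instance (i : instance) : data :=
  dcons (enc_seq [seq enc_seq [seq enc_bool (edge u v) | v <- enum 'I_(nvert i)]
                 | u <- enum 'I_(nvert i)])
    (dcons (enc_seq [seq enc_nat (cost v) | v <- enum 'I_(nvert i)])
           (enc_seq [seq enc_nat (weight v) | v <- enum 'I_(nvert i)])).

Definition sum_over (T : finType) (f : T -> nat) (X : {set T}) : nat :=
  \sum_(v in X) f v.

Section MinRatioVertexCut.
Variable i : instance.

Record cut := Cut {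
  sideA : {set 'I_(nvert i)};
  sep : {set 'I_(nvert i)};
  sideB : {set 'I_(nvert i)}
}.

Definition enc_cut (K : cut) : data :=
  dcons (enc_set (sideA K)) (dcons (enc_set (sep K)) (enc_set (sideB K))).

(* Parts may be empty: a complete graph has no such partition with both sides
   nonempty. *)
Definition is_cut (K : cut) : Prop :=
  [/\ sideA K :|: sep K :|: sideB K = setT,
      [disjoint sideA K & sep K], [disjoint sideA K & sideB K],
      [disjoint sep K & sideB K] &
      forall u v, u \in sideA K -> v \in sideB K -> ~~ edge u v].

Definition cut_denom (K : cut) : nat :=
  sum_over (@weight i) (sideA K :|: sep K) * sum_over (@weight i) (sideB K :|: sep K).

Definition cut_ratio (R : realFieldType) (K : cut) : R :=
  ((sum_over (@cost i) (sep K))%:R / (cut_denom K)%:R)%R.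

(* A ratio with denominator 0, be it 0/0, counts as infinite. *)
Definition optimal_cut (R : realFieldType) (K : cut) : Prop :=
  [/\ is_cut K, 0 < cut_denom K &
      forall K', is_cut K' -> 0 < cut_denom K' ->
        (cut_ratio R K <= cut_ratio R K')%R].

(* There is an optimal cut unless all weights are 0; in that case every
   partition is accepted. *)
Definition approx_cut (R : realFieldType) (f : nat -> R) (K : cut) : Prop :=
  is_cut K /\
  forall K', optimal_cut R K' ->
    0 < cut_denom K /\ (cut_ratio R K <= f (nvert i) * cut_ratio R K')%R.

End MinRatioVertexCut.

Inductive tree (T : Type) := Node of T & seq (tree T).

Fixpoint vertices (T : Type) (D : tree T) : seq T :=
  let: Node r ts := D in r :: flatten [seq vertices t | t <- ts].

Fixpoint enc_tree (n : nat) (D : tree 'I_n) : data :=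
  let: Node r ts := D in
  dcons (enc_vertex r) (enc_seq [seq enc_tree t | t <- ts]).

Section DecisionTree.
Variables (T : finType) (e : rel T).

Definition induced (X : {set T}) : rel T :=
  [rel u v | [&& u \in X, v \in X & e u v]].

Definition components (X : {set T}) : {set {set T}} :=
  equivalence_partition (connect (induced X)) X.

(* [decision_tree X D]: D is a decision tree for the subgraph induced by X. *)
Fixpoint decision_tree (X : {set T}) (D : tree T) : bool :=
  let: Node r ts := D in
  [&& r \in X,
      perm_eq [seq [set x in vertices t] | t <- ts]
              (enum (components (X :\ r))) &
      all (fun t => decision_tree [set x in vertices t] t) ts].

Fixpoint query_path (D : tree T) (x : T) : seq T :=
  let: Node r ts := D in
  r :: (if x == r then [::] else
        flatten [seq if x \in vertices t then query_path t x else [::]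
                | t <- ts]).

Definition tree_cost (c w : T -> nat) (D : tree T) : nat :=
  \sum_(x : T) w x * \sum_(q <- query_path D x) c q.

End DecisionTree.

Section GraphSearch.
Variable i : instance.

Definition is_OPT (m : nat) : Prop :=
  (exists2 D, decision_tree (@edge i) setT D &
     tree_cost (@cost i) (@weight i) D = m) /\
  (forall D, decision_tree (@edge i) setT D ->
     m <= tree_cost (@cost i) (@weight i) D).

Definition approx_tree (R : realFieldType) (g : nat -> R)
    (D : tree 'I_(nvert i)) : Prop :=
  decision_tree (@edge i) setT D /\
  exists2 m, is_OPT m &
    ((tree_cost (@cost i) (@weight i) D)%:R <= g (nvert i) * m%:R)%R.

End GraphSearch.

Definition min_ratio_cut_algorithm (R : realFieldType) (f : nat -> R)
    (p : prog) : Prop :=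
  polytime_solves enc_instance enc_cut (fun i => @approx_cut i R f) p.

Definition graph_search_algorithm (R : realFieldType) (g : nat -> R)
    (p : prog) : Prop :=
  polytime_solves enc_instance (fun i => @enc_tree (nvert i))
    (fun i => @approx_tree i R g) p.

(* Main.v *)
Require Import Defs.
From HB Require Import structures.
From mathcomp Require Import all_boot all_order all_algebra.
From mathcomp Require Import zify.
From Stdlib Require Import Classical ClassicalEpsilon.

(** Query a cheap vertex separator of the current component, then recurse.  Let
    [H] be a component of weight [W], [S] the separator returned for it, [m] the
    weight of [H] missed by each component of [H \ S], and [D*] an optimal
    decision tree.  The set [S*] of the queries of [D*] whose subtree carries more
    than half of the weight of [H] separates [H] into parts of weight at most [W / 2], so that
    grouping the parts gives a cut of ratio at most [8 c(S* ) / W^2]; hence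
    [c(S) W <= 8 f c(S* ) m].  The left-hand side is what the queries in [S]
    cost.  The right-hand side is paid by the potential
    [sum_q c(q) min(w(component of q), 2 w(subtree of q in D* ))], which is at
    most [2 OPT] at the start and drops by [c(S* ) m] at this step; so no
    logarithmic factor is lost.

    The program records only the order in which vertices are separated off.  The
    tree is rebuilt from that order backwards: each vertex becomes the root over
    the trees of the later components adjacent to it. *)

Set Implicit Arguments.
Unset Strict Implicit.
Unset Printing Implicit Defensive.

Import Order.TTheory GRing.Theory Num.Theory.

(** * Components and decision trees *)

(** The approximate cut need not be balanced: a step may split off only a small weight [m] while its
    queries cost c(S) times all of W, so comparing every step with OPT separately would add up over
    many steps. The product in the denominator of the ratio is what helps. It is at most W times its
    smaller factor, so one W cancels and the charge becomes proportional to [m], the amount by which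
    every surviving part shrinks. For the queries in the heavy set of the optimal tree the subtree
    term of the potential is not the smaller one, so it is these queries whose terms fall by [m].
    The program does not know an optimal tree, so the estimates hold for all decision trees at once.
    No sign of [f] is assumed; it is extracted from the correctness of the cut algorithm. The cut
    program is known to halt only on encodings of instances, so running times are relative to a
    domain of inputs, and the main loop carries an invariant that keeps every query in that
    domain. *)

Section InducedComponents.
Variables (T : finType) (e : rel T).
Hypothesis e_sym : symmetric e.

Definition connected (Y : {set T}) : Prop :=
  forall u v, u \in Y -> v \in Y -> connect (induced e Y) u v.

Definition closed_in (X Z : {set T}) : Prop :=
  forall u v, u \in Z -> v \in X -> e u v -> v \in Z.

Definition component (X : {set T}) (q : T) : {set T} :=
  [set y in X | connect (induced e X) q y].

Lemma connect_induced_sym (X : {set T}) : connect_sym (induced e X).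
Proof.
apply: sym_connect_sym => u v; rewrite /induced /= e_sym.
by case: (u \in X); case: (v \in X).
Qed.

Lemma connect_closed_in (X Z : {set T}) (u v : T) :
  closed_in X Z -> u \in Z -> connect (induced e X) u v -> v \in Z.
Proof.
move=> ZX + /connectP[p + ->]; elim: p u => [|y p IHp] u //= uZ.
by case/andP=> /and3P[_ yX uy]; apply: IHp; apply: ZX uy.
Qed.

Lemma component_sub (X : {set T}) (q : T) : component X q \subset X.
Proof. by apply/subsetP=> y; rewrite inE => /andP[]. Qed.

Lemma mem_component (X : {set T}) (q : T) : q \in X -> q \in component X q.
Proof. by move=> qX; rewrite inE qX connect0. Qed.

Lemma component_closed (X : {set T}) (q : T) : closed_in X (component X q).
Proof.
move=> u v; rewrite !inE => /andP[uX qu] vX uv; rewrite vX /=.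
by apply: connect_trans qu _; apply: connect1; rewrite /induced /= uX vX.
Qed.

Lemma connected_sub_closed (X Y Z : {set T}) (q : T) :
  connected Y -> Y \subset X -> closed_in X Z -> q \in Y -> q \in Z -> Y \subset Z.
Proof.
move=> Yc /subsetP YX ZX qY qZ; apply/subsetP=> y yY.
apply: (@connect_closed_in Y Z q) => //; last exact: Yc.
by move=> u v uZ vY; apply: ZX => //; apply: YX.
Qed.

(** Closed sets replace explicit paths: the hypothesis is applied to the component of [u], which is
    closed and nonempty. *)
Lemma connectedI (Y : {set T}) :
  (forall (Z : {set T}) z, z \in Z -> Z \subset Y -> closed_in Y Z -> Y \subset Z) -> connected Y.
Proof.
move=> YZ u v uY vY.
have /subsetP/(_ _ vY) := YZ _ _ (mem_component uY) (component_sub _ _) (@component_closed Y u).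
by rewrite inE => /andP[].
Qed.

Lemma component_connected (X : {set T}) (q : T) : connected (component X q).
Proof.
apply: connectedI => Z z zZ /subsetP ZC Zcl; apply/subsetP=> y yC.
have ZX : closed_in X Z.
  move=> u v uZ vX uv; apply: (Zcl u) => //.
  by apply: (component_closed (ZC _ uZ)).
apply: (connect_closed_in ZX zZ).
move: (ZC _ zZ) yC; rewrite !inE => /andP[_ qz] /andP[_ qy].
by apply: connect_trans qy; rewrite connect_induced_sym.
Qed.

Lemma connected_sub_component (X Y : {set T}) (q : T) :
  connected Y -> Y \subset X -> q \in Y -> Y \subset component X q.
Proof.
move=> Yc YX qY; apply: (connected_sub_closed Yc YX) (qY) _.
  exact: component_closed.
by apply: mem_component; apply: (subsetP YX).
Qed.

Lemma componentS (X X' : {set T}) (q : T) :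
  X \subset X' -> component X q \subset component X' q.
Proof.
move=> XX'; case qX: (q \in X); last first.
  (* For [q] outside [X] the left-hand side is empty, since a path starting in [X] never leaves
     [X]. *)
  apply/subsetP=> y; rewrite inE => /andP[yX]; rewrite connect_induced_sym => yq.
  have XcX: closed_in X X by move=> u v _.
  by move: (connect_closed_in XcX yX yq); rewrite qX.
apply: connected_sub_component (mem_component qX); first exact: component_connected.
exact: subset_trans (component_sub _ _) XX'.
Qed.

(** This form, free of equivalence classes, is what the merging and rebuilding arguments work
    with. *)
Lemma componentsP (X Y : {set T}) :
  reflect [/\ Y != set0, Y \subset X, connected Y & closed_in X Y]
          (Y \in components e X).
Proof.
apply: (iffP imsetP) => [[q qX ->]|[/set0Pn[q qY] YX Yc YX']].
  rewrite -/(component X q); split.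
  - by apply/set0Pn; exists q; apply: mem_component.
  - exact: component_sub.
  - exact: component_connected.
  - exact: component_closed.
exists q; first exact: (subsetP YX).
rewrite -/(component X q); apply/eqP; rewrite eqEsubset connected_sub_component //.
apply: (connected_sub_closed (@component_connected X q) (component_sub _ _) YX' _ qY).
by apply: mem_component; apply: (subsetP YX).
Qed.

Lemma components_eq (X Y Z : {set T}) (q : T) :
  Y \in components e X -> Z \in components e X -> q \in Y -> q \in Z -> Y = Z.
Proof.
move=> /componentsP[_ YX Yc Ycl] /componentsP[_ ZX Zc Zcl] qY qZ.
apply/eqP; rewrite eqEsubset.
by rewrite (connected_sub_closed Yc YX Zcl qY qZ) (connected_sub_closed Zc ZX Ycl qZ qY).
Qed.

Lemma mem_components (X : {set T}) (q : T) : q \in X -> component X q \in components e X.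
Proof. by move=> qX; apply/imsetP; exists q. Qed.

Lemma component_componentE (X Y : {set T}) (q : T) :
  Y \in components e X -> q \in Y -> component X q = Y.
Proof.
move=> YX qY; have [_ /subsetP/(_ _ qY) qX _ _] := componentsP _ _ YX.
by apply: (components_eq (mem_components qX) YX _ qY); apply: mem_component.
Qed.

(** One step of rebuilding the tree backwards: returning [v] to the graph glues together the
    components adjacent to it and leaves the others alone. [N] will be the vertex set of the tree
    rooted at [v]. *)
Lemma components_setU1 (P : {set T}) (v : T) (Y : {set T}) :
  v \notin P ->
  let adj (A : {set T}) := [exists u in A, e v u] in
  let N := v |: \bigcup_(A in components e P | adj A) A in
  (Y \in components e (v |: P)) = (Y == N) || ((Y \in components e P) && ~~ adj Y).
Proof.
move=> vP adj N.
have NP : N \subset v |: P.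
  apply/subsetP=> y; rewrite /N !inE => /orP[->//|/bigcupP[A /andP[/componentsP[_ /subsetP AP _ _] _] yA]].
  by rewrite AP ?orbT.
have NcomP : N \in components e (v |: P).
  apply/componentsP; split => //.
  - by apply/set0Pn; exists v; rewrite !inE eqxx.
  - apply: connectedI => Z z zZ /subsetP ZN Zcl.
    have sub A : A \in components e P -> adj A -> forall a, a \in A -> a \in Z -> A \subset Z.
      move=> AP Aadj a aA aZ; have [_ _ Ac _] := componentsP _ _ AP.
      apply: (@connected_sub_closed N A Z a) => //.
      apply/subsetP=> y yA; rewrite !inE; apply/orP; right.
      by apply/bigcupP; exists A => //; rewrite AP.
    (* Either [z] is [v], or [z] lies in an adjacent component; [Z] swallows that component,
       including a neighbour of [v]. *)
    have vZ : v \in Z.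
      move: (ZN _ zZ); rewrite !inE => /orP[/eqP<-//|/bigcupP[A /andP[AP Aadj] zA]].
      case/exists_inP: (Aadj) => u uA vu.
      apply: (Zcl u); last by rewrite e_sym.
        by apply: (subsetP (sub A AP Aadj z zA zZ)).
      by rewrite !inE eqxx.
    apply/subsetP=> y; rewrite !inE => /orP[/eqP->//|/bigcupP[A /andP[AP Aadj] yA]].
    case/exists_inP: (Aadj) => u uA vu.
    apply: (subsetP (sub A AP Aadj u uA _)) => //; apply: (Zcl v) => //.
    by rewrite !inE; apply/orP; right; apply/bigcupP; exists A => //; rewrite AP.
  - move=> x y xN yP xy; rewrite !inE.
    case: (eqVneq y v) => //= yv.
    have yP' : y \in P by move: yP; rewrite !inE (negPf yv).
    apply/bigcupP; exists (component P y); last exact: mem_component.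
    rewrite mem_components //=; apply/exists_inP.
    move: xN; rewrite !inE => /orP[/eqP xv|].
      by exists y; [exact: mem_component | rewrite -xv].
    case/bigcupP=> A /andP[AP Aadj] xA; case/exists_inP: (Aadj) => u uA vu.
    have [_ _ _ Acl] := componentsP _ _ AP.
    exists u => //; rewrite (@component_componentE _ A) //.
    exact: Acl xy.
case: (eqVneq Y N) => [->//|YN] /=.
apply/idP/andP => [YP|[YP Yadj]].
  have [Y0 YS Yc Ycl] := componentsP _ _ YP.
  have vY : v \notin Y.
    apply: contra YN => vY; apply/eqP; apply: (components_eq YP NcomP vY).
    by rewrite !inE eqxx.
  split; last first.
    apply/exists_inP=> -[u uY vu]; move/negP: vY; apply.
    by apply: (Ycl u); rewrite ?inE ?eqxx // e_sym.
  apply/componentsP; split => //.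
    apply/subsetP=> y yY; move/subsetP/(_ _ yY): YS; rewrite !inE.
    by case: eqVneq yY => // ->; rewrite (negPf vY).
  by move=> x y xY yP; apply: Ycl => //; rewrite !inE yP orbT.
have [Y0 YS Yc Ycl] := componentsP _ _ YP.
apply/componentsP; split => //.
  by apply: subset_trans YS _; apply: subsetUr.
move=> x y xY; rewrite !inE => /orP[/eqP->|]; last exact: Ycl.
by move=> xv; case/exists_inP: Yadj; exists x; rewrite // e_sym.
Qed.

(** With [f] the adjacency to [v], this identifies the components left when [v] is removed from its
    tree, hence the children of [v]. *)
Lemma components_bigcup (P : {set T}) (f : pred {set T}) (Y : {set T}) :
  (Y \in components e (\bigcup_(A in components e P | f A) A)) = (Y \in components e P) && f Y.
Proof.
set N := \bigcup_(A in _ | _) _.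
have main A : A \in components e P -> f A -> A \in components e N.
  move=> AP fA; have [A0 AS Ac Acl] := componentsP _ _ AP.
  apply/componentsP; split => //; first by apply: bigcup_sup; rewrite AP.
  move=> u v uA /bigcupP[B /andP[/componentsP[_ /subsetP BP _ _] _] vB].
  by apply: Acl => //; apply: BP.
apply/idP/andP => [YN|[]]; last exact: main.
have [/set0Pn[y yY] /subsetP/(_ _ yY)/bigcupP[A /andP[AP fA] yA] _ _] := componentsP _ _ YN.
by rewrite (components_eq YN (main A AP fA) yY yA).
Qed.

End InducedComponents.

Section TreeEqType.
Variable T : Type.

(** Equality on trees is transported from [GenTree.tree], with the root label stored as a leaf in
    front of the children. *)
Fixpoint gentree_of_tree (D : tree T) : GenTree.tree T :=
  let: Node r ts := D in
  GenTree.Node 0 (GenTree.Leaf r :: [seq gentree_of_tree t | t <- ts]).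

Fixpoint tree_of_gentree (D : GenTree.tree T) : option (tree T) :=
  if D is GenTree.Node _ (GenTree.Leaf r :: ts)
  then Some (Node r (pmap tree_of_gentree ts)) else None.

(** The hypothesis on the children is a folded conjunction because membership in [ts] needs an
    equality on trees; [tree_ind_mem] restates it with membership. *)
Fixpoint tree_ind_nested (P : tree T -> Prop)
    (IH : forall r ts, foldr (fun t => and (P t)) True ts -> P (Node r ts)) (D : tree T) : P D :=
  let: Node r ts := D in
  IH r ts ((fix loop ts : foldr (fun t => and (P t)) True ts :=
    if ts is t :: ts' then conj (tree_ind_nested IH t) (loop ts') else Logic.I) ts).

Lemma gentree_of_treeK : pcancel gentree_of_tree tree_of_gentree.
Proof.
elim/tree_ind_nested => r ts IH /=; congr (Some (Node r _)).
by elim: ts IH => //= t ts IHts [-> /IHts ->].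
Qed.
End TreeEqType.

HB.instance Definition _ (T : eqType) :=
  Equality.copy (tree T) (pcan_type (@gentree_of_treeK T)).

Lemma tree_ind_mem (T : eqType) (P : tree T -> Prop) :
  (forall r ts, {in ts, forall t, P t} -> P (Node r ts)) -> forall D, P D.
Proof.
move=> IH; elim/tree_ind_nested => r ts Pts; apply: IH.
elim: ts Pts => //= t ts IHts [Pt /IHts Pts] s.
by rewrite inE => /orP[/eqP->//|]; apply: Pts.
Qed.

Section DecisionTrees.
Variables (T : finType) (e : rel T).
Hypothesis e_sym : symmetric e.

Lemma decision_tree_child (X : {set T}) r ts t :
  decision_tree e X (Node r ts) -> t \in ts ->
  ([set x in vertices t] \in components e (X :\ r)) *
  decision_tree e [set x in vertices t] t.
Proof.
move=> /= /and3P[_ ch /allP dt] tts; split; last exact: dt.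
by rewrite -mem_enum -(perm_mem ch); apply/mapP; exists t.
Qed.

Lemma child_of_component (X : {set T}) r ts (Y : {set T}) :
  decision_tree e X (Node r ts) -> Y \in components e (X :\ r) ->
  exists2 t, t \in ts & Y = [set x in vertices t].
Proof.
by move=> /= /and3P[_ ch _]; rewrite -mem_enum -(perm_mem ch) => /mapP[t tts ->]; exists t.
Qed.

Lemma child_vertices (X : {set T}) r ts t x :
  decision_tree e X (Node r ts) -> t \in ts -> x \in vertices t -> x \in X :\ r.
Proof.
move=> dt tts xt; have [/(componentsP e_sym)[_ /subsetP tX _ _] _] := decision_tree_child dt tts.
by apply: tX; rewrite inE.
Qed.

(** [query_path] concatenates the contributions of all children. Only the child containing [x]
    contributes, since distinct children carry distinct, hence disjoint, components. *)
Lemma query_path_child (X : {set T}) r ts t x :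
  decision_tree e X (Node r ts) -> t \in ts -> x \in vertices t ->
  query_path (Node r ts) x = r :: query_path t x.
Proof.
move=> dt tts xt /=.
have /setD1P[/negPf-> _] := child_vertices dt tts xt.
have tsU : uniq [seq [set x in vertices t] | t <- ts].
  by case/and3P: dt => _ /perm_uniq->; rewrite enum_uniq.
have other t' : t' \in ts -> x \in vertices t' -> [set x in vertices t'] = [set x in vertices t].
  move=> t'ts xt'; apply: (@components_eq _ _ e_sym (X :\ r) _ _ x); rewrite ?inE //.
    by case: (decision_tree_child dt t'ts).
  by case: (decision_tree_child dt tts).
congr (_ :: _); clear dt.
case/splitPr: tts tsU other => p1 p2.
rewrite map_cat cat_uniq /= negb_or => /and4P[_ /andP[tp1 _] tp2 _] other.
have flat0 p : {subset p <= p1 ++ t :: p2} ->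
    [set x in vertices t] \notin [seq [set x in vertices t] | t <- p] ->
    flatten [seq if x \in vertices t then query_path t x else [::] | t <- p] = [::].
  move=> sub tp; apply/nilP; rewrite /nilp size_flatten sumnE !big_map big1_seq // => s /= sp.
  case: ifP => // xs; case/negP: tp; apply/mapP; exists s => //.
  by rewrite (other s) // sub.
rewrite map_cat flatten_cat /= xt !flat0 ?cats0 // => s sp.
  by rewrite mem_cat inE sp !orbT.
by rewrite mem_cat sp.
Qed.

Lemma query_path_vertices (X : {set T}) (D : tree T) x :
  decision_tree e X D -> x \in X -> {subset query_path D x <= X}.
Proof.
elim/tree_ind_mem: D X => r ts IH X dt xX.
have rX : r \in X by case/and3P: dt.
have [->|xr] := eqVneq x r.
  by rewrite /= eqxx => y; rewrite inE => /eqP->.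
have xXr : x \in X :\ r by rewrite !inE xr.
have [t tts tE] := child_of_component dt (mem_components e xXr).
have xt : x \in vertices t.
  by have := mem_component e xXr; rewrite tE inE.
rewrite (query_path_child dt tts xt) => y; rewrite inE => /orP[/eqP->//|yt].
have [_ dtt] := decision_tree_child dt tts.
have := IH t tts _ dtt; rewrite inE => /(_ xt _ yt); rewrite inE => /(child_vertices dt tts).
by case/setD1P.
Qed.

Lemma query_path_uniq (X : {set T}) (D : tree T) x :
  decision_tree e X D -> x \in X -> uniq (query_path D x).
Proof.
elim/tree_ind_mem: D X => r ts IH X dt xX.
have [->|xr] := eqVneq x r; first by rewrite /= eqxx.
have xXr : x \in X :\ r by rewrite !inE xr.
have [t tts tE] := child_of_component dt (mem_components e xXr).
have xt : x \in vertices t.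
  by have := mem_component e xXr; rewrite tE inE.
have [_ dtt] := decision_tree_child dt tts.
rewrite (query_path_child dt tts xt) /= (IH t tts _ dtt) ?inE // andbT.
apply/negP=> /(query_path_vertices dtt); rewrite !inE => /(_ xt) rt.
by have /setD1P[] := child_vertices dt tts rt; rewrite eqxx.
Qed.

(* The first vertex of Y to be queried separates Y from the rest of the graph:
   until then all of Y lies in one component. *)
Lemma connected_dominated (X Y : {set T}) (D : tree T) y :
  decision_tree e X D -> connected e Y -> Y \subset X -> y \in Y ->
  exists2 v, v \in Y & {in Y, forall x, v \in query_path D x}.
Proof.
move=> + Yc; elim/tree_ind_mem: D X => r ts IH X dt YX yY.
have [rY|rY] := boolP (r \in Y).
  by exists r => // x _; rewrite /= inE eqxx.
have YXr : Y \subset X :\ r by rewrite subsetD1 YX.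
have yXr := subsetP YXr _ yY.
have [t tts tE] := child_of_component dt (mem_components e yXr).
have Yt : Y \subset [set x in vertices t].
  by rewrite -tE; apply: connected_sub_component.
have [_ dtt] := decision_tree_child dt tts.
have [v vY vP] := IH t tts _ dtt Yt yY.
exists v => // x xY; rewrite (query_path_child dt tts) ?inE ?vP ?orbT //.
by have := subsetP Yt _ xY; rewrite inE.
Qed.

(** The vertex set of the subtree rooted at [q], read off from the query paths so that the subtree
    need not be located. *)
Definition subtree_set (D : tree T) (q : T) : {set T} := [set x | q \in query_path D x].

(** Double counting: each query is paid once by every vertex below it. Uniqueness of the path turns
    the inner sum over a list into a sum over a set. *)
Lemma tree_costE (c w : T -> nat) (D : tree T) : decision_tree e setT D ->
  tree_cost c w D = \sum_q c q * sum_over w (subtree_set D q).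
Proof.
move=> dt; rewrite /tree_cost /sum_over.
transitivity (\sum_x \sum_(q | q \in query_path D x) w x * c q).
  apply: eq_bigr => x _; rewrite big_uniq /=; first exact: big_distrr.
  by apply: (query_path_uniq dt); rewrite inE.
rewrite (exchange_big_dep predT) //=; apply: eq_bigr => q _.
rewrite big_distrr /=; apply: eq_big => [x|x _]; last exact: mulnC.
by rewrite inE.
Qed.

End DecisionTrees.

(** * Decision forests built backwards from an elimination order *)

Section EliminationForest.
Variables (T : finType) (e : rel T).
Hypothesis e_sym : symmetric e.

Definition adjacent (v : T) (A : {set T}) : bool := [exists u in A, e v u].

Definition forest_add (F : seq ({set T} * tree T)) (v : T) : seq ({set T} * tree T) :=
  let ch := [seq p <- F | adjacent v p.1] in
  (v |: \bigcup_(p <- ch) p.1, Node v [seq p.2 | p <- ch])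
    :: [seq p <- F | ~~ adjacent v p.1].

(** The last clause says that the subtree of [q] lies inside [B q]; the cost is bounded through
    it. *)
Definition decision_forest (B : T -> {set T}) (P : {set T}) (F : seq ({set T} * tree T)) : Prop :=
  [/\ perm_eq [seq p.1 | p <- F] (enum (components e P)),
      forall p, p \in F -> p.1 = [set x in vertices p.2] /\ decision_tree e p.1 p.2 &
      forall p x q, p \in F -> x \in p.1 -> q \in query_path p.2 x -> x \in B q].

(* The first vertex of [o] is the last one to be queried. *)
Fixpoint elimination_bound (B : T -> {set T}) (o : seq T) : Prop :=
  if o is v :: s then
    (forall Y, connected e Y -> v \in Y -> {in Y, forall y, y \notin s} -> Y \subset B v)
    /\ elimination_bound B s
  else True.

(** The only new subtree is that of [v]. Its vertex set is a component of [v |: P], so it is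
    connected and falls under the hypothesis on [B v]; all other subtrees are inherited. *)
Lemma decision_forest_add (B : T -> {set T}) (P : {set T}) F v :
  v \notin P ->
  (forall Y, connected e Y -> v \in Y -> Y \subset v |: P -> Y \subset B v) ->
  decision_forest B P F -> decision_forest B (v |: P) (forest_add F v).
Proof.
move=> vP Bv [perm dt path].
have memF A : (A \in [seq p.1 | p <- F]) = (A \in components e P).
  by rewrite (perm_mem perm) mem_enum.
have uF : uniq [seq p.1 | p <- F] by rewrite (perm_uniq perm) enum_uniq.
set ch := [seq p <- F | adjacent v p.1].
have mem_ch A : (A \in [seq p.1 | p <- ch]) = (A \in components e P) && adjacent v A.
  by rewrite /ch -(filter_map (fun p => p.1)) mem_filter memF andbC.
set N := \bigcup_(A in components e P | adjacent v A) A.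
have chN : \bigcup_(p <- ch) p.1 = N.
  rewrite -(big_map (fun p => p.1) xpredT id) big_uniq /=; last first.
    by rewrite /ch -(filter_map (fun p => p.1)) filter_uniq.
  by apply: eq_bigl => A; rewrite mem_ch.
have NchP y : reflect (exists2 p, p \in ch & y \in p.1) (y \in N).
  apply: (iffP bigcupP) => [[A + yA]|[p pch yp]].
    by rewrite -mem_ch => /mapP[p pch AE]; exists p; rewrite -?AE.
  by exists p.1 => //; rewrite -mem_ch map_f.
have vN : v \notin N.
  apply/bigcupP => -[A /andP[/(componentsP e_sym)[_ /subsetP AP _ _] _] /AP].
  by rewrite (negPf vP).
have newP : v |: N \in components e (v |: P) by rewrite components_setU1 // eqxx.
have dtN : decision_tree e (v |: N) (Node v [seq p.2 | p <- ch]).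
  rewrite /=; apply/and3P; split; first by rewrite !inE eqxx.
    have -> : (v |: N) :\ v = N.
      apply/setP=> y; rewrite !inE; case: eqVneq => //= ->; first by rewrite (negPf vN).
    rewrite -map_comp (_ : map _ ch = [seq p.1 | p <- ch]); last first.
      apply/eq_in_map => p; rewrite mem_filter => /andP[_ pF] /=.
      by have [<-] := dt p pF.
    apply: uniq_perm; rewrite ?enum_uniq //.
      by rewrite /ch -(filter_map (fun p => p.1)) filter_uniq.
    by move=> A; rewrite mem_ch mem_enum components_bigcup.
  apply/allP => t /mapP[p]; rewrite mem_filter => /andP[_ pF] ->.
  by have [<-] := dt p pF.
have vertN : [set x in vertices (Node v [seq p.2 | p <- ch])] = v |: N.
  apply/setP=> y; rewrite !inE; congr (_ || _).
  apply/flatten_mapP/NchP => [[t /mapP[p pch ->] yt]|[p pch yp]].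
    exists p => //; have [|-> _] := dt p; first by move: pch; rewrite mem_filter => /andP[].
    by rewrite inE yt.
  exists p.2; first by apply: map_f.
  move: yp; have [|-> _] := dt p; first by move: pch; rewrite mem_filter => /andP[].
  by rewrite inE.
split.
- rewrite /forest_add /= -/ch chN; apply: uniq_perm; rewrite ?enum_uniq //=.
    rewrite -(filter_map (fun p => p.1) (fun A => ~~ adjacent v A)) filter_uniq // andbT.
    rewrite mem_filter negb_and memF; apply/orP; right.
    apply/negP => /(componentsP e_sym)[_ /subsetP/(_ v) + _ _].
    by rewrite (negPf vP) !inE eqxx => /(_ isT).
  move=> A; rewrite inE mem_enum components_setU1 // -/N; congr (_ || _).
  by rewrite -(filter_map (fun p => p.1) (fun A => ~~ adjacent v A)) mem_filter memF andbC.
- move=> p; rewrite /forest_add inE => /orP[/eqP->|] /=; rewrite -/ch.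
    by rewrite chN.
  by rewrite mem_filter => /andP[_]; apply: dt.
- move=> p x q; rewrite /forest_add inE => /orP[/eqP->|]; last first.
    by rewrite mem_filter => /andP[_]; apply: path.
  rewrite -/ch chN [in x \in _]/= => xN.
  have NB : v |: N \subset B v.
    have [_ NP Nc _] := componentsP e_sym _ _ newP.
    by apply: Bv => //; rewrite !inE eqxx.
  have [xv|xv] := eqVneq x v.
    by rewrite /= xv eqxx inE => /eqP->; apply: (subsetP NB); rewrite !inE eqxx.
  have [p' p'ch xp'] : exists2 p', p' \in ch & x \in p'.1.
    by move: xN; rewrite !inE (negPf xv) => /NchP.
  have p'F : p' \in F by move: p'ch; rewrite mem_filter => /andP[].
  have [p'E _] := dt p' p'F.
  have := query_path_child e_sym dtN (map_f _ p'ch).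
  move=> /(_ x) ->; last by move: xp'; rewrite p'E inE.
  rewrite inE => /orP[/eqP->|]; first exact: (subsetP NB).
  exact: path.
Qed.

Lemma decision_forest_fold (B : T -> {set T}) (o : seq T) (P : {set T}) F :
  uniq o -> {in o, forall v, v \notin P} -> elimination_bound B o ->
  decision_forest B P F ->
  decision_forest B (P :|: [set v in o]) (foldl forest_add F o).
Proof.
elim: o P F => [|v s IHs] P F /=.
  by move=> _ _ _; rewrite (_ : P :|: _ = P) //; apply/setP=> v; rewrite !inE orbF.
move=> /andP[vs us] oP [Bv Bs] FP.
have -> : P :|: [set v0 in v :: s] = v |: P :|: [set v0 in s].
  by apply/setP=> y; rewrite !inE orbCA orbA.
apply: IHs => //.
  move=> u us'; rewrite !inE negb_or (oP u) ?inE ?us' ?orbT // andbT.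
  by apply: contraTneq us' => ->.
apply: decision_forest_add => //; first by rewrite oP ?inE ?eqxx.
(* A set inside [v |: P] avoids [s], whose vertices are added only later. *)
move=> Y Yc vY /subsetP YP; apply: Bv => // y /YP; rewrite !inE => /orP[/eqP->//|yP].
by apply/negP=> ys; move: yP; rewrite (negPf (oP _ _)) // inE ys orbT.
Qed.

Definition elimination_tree (o : seq T) (D : tree T) : Prop :=
  foldl forest_add [::] o = [:: (setT, D)].

Lemma elimination_treeP (B : T -> {set T}) (o : seq T) (x0 : T) :
  connected e setT -> uniq o -> (forall v, v \in o) -> elimination_bound B o ->
  exists D, [/\ elimination_tree o D, decision_tree e setT D &
    forall x q, q \in query_path D x -> x \in B q].
Proof.
move=> Tc uo oT Bo.
have [] : decision_forest B (set0 :|: [set v in o]) (foldl forest_add [::] o).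
  apply: decision_forest_fold => //; first by move=> v _; rewrite inE.
  split=> //; rewrite (_ : components e set0 = set0) ?enum_set0 //.
  by apply/setP=> A; rewrite inE; apply/imsetP => -[x]; rewrite inE.
have -> : set0 :|: [set v in o] = setT by apply/setP=> v; rewrite !inE oT.
(* A connected graph is its own only component, so the final forest is a single tree; [x0] shows
   that it is nonempty. *)
have -> : components e setT = [set setT].
  apply/setP=> A; rewrite inE; apply/(componentsP e_sym)/eqP => [[/set0Pn[a aA] _ _ Acl]|->].
    apply/eqP; rewrite eqEsubset subsetT /=.
    by apply: (connected_sub_closed Tc (subsetT _) Acl (q := a)); rewrite ?inE.
  by split=> //; apply/set0Pn; exists x0.
rewrite enum_set1 /elimination_tree; case: foldl => [|[A D] [|? ?]] perm; have /perm_size // := perm.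
move: perm => /perm_mem/(_ A); rewrite !inE eqxx => AT _; have /eqP-> : A == setT by rewrite -AT.
move=> dt path.
exists D; split=> // [|x q]; first by have [] := dt _ (mem_head _ _).
by apply: (path _ _ _ (mem_head _ _)); rewrite inE.
Qed.

End EliminationForest.

(** * The cost of an elimination order *)

Section SumOver.
Variables (T : finType) (w : T -> nat).

Lemma sum_overS (A B : {set T}) : A \subset B -> sum_over w A <= sum_over w B.
Proof.
move=> /subsetP AB; rewrite /sum_over [leqRHS](bigID (mem A)) /=.
apply: leq_trans (leq_addr _ _); rewrite [leqRHS](eq_bigl (fun x => x \in A)) // => x /=.
by rewrite andb_idl //; apply: AB.
Qed.

Lemma sum_overU (A B : {set T}) : [disjoint A & B] ->
  sum_over w (A :|: B) = sum_over w A + sum_over w B.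
Proof. by move=> AB; rewrite /sum_over -bigU //; apply: eq_bigl => x; rewrite !inE. Qed.

Lemma sum_over_disjoint_leq (A B C : {set T}) : A \subset C -> B \subset C -> [disjoint A & B] ->
  sum_over w A + sum_over w B <= sum_over w C.
Proof. by move=> sA sB AB; rewrite -sum_overU // sum_overS // subUset sA. Qed.

Lemma sum_over_set0 : sum_over w set0 = 0.
Proof. by rewrite /sum_over big_set0. Qed.
End SumOver.

Section EliminationCost.
Variables (T : finType) (e : rel T) (c w : T -> nat).
Hypothesis e_sym : symmetric e.
Variables (R : realFieldType) (a : R).
Hypothesis a_ge0 : (0 <= a)%R.

(** The set S* of the overview, for the tree [D]. Since [D] searches the whole graph and not [H],
    both its queries and its subtrees are cut down to [H]. *)
Definition heavy (D : tree T) (H : {set T}) : {set T} :=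
  [set q in H | sum_over w H < 2 * sum_over w (subtree_set D q :&: H)].

(* m is what every component of H \ S misses of the weight of H. *)
Definition cheap_separator (H S : {set T}) : Prop :=
  [/\ S \subset H, S != set0 & forall D, decision_tree e setT D -> exists m,
    [/\ m <= sum_over w H,
        forall Y, connected e Y -> Y \subset H :\: S -> m + sum_over w Y <= sum_over w H &
        ((sum_over c S * sum_over w H)%:R <= a * (sum_over c (heavy D H) * m)%:R)%R]].

Definition potential (D : tree T) (U : {set T}) : nat :=
  \sum_(q in U) c q * minn (sum_over w (component e U q)) (2 * sum_over w (subtree_set D q)).

Lemma potentialT (D : tree T) : decision_tree e setT D ->
  potential D setT <= 2 * tree_cost c w D.
Proof.
move=> dt; rewrite (tree_costE e_sym _ _ dt) big_distrr /=.
rewrite /potential (eq_bigl xpredT) => [|q]; last by rewrite inE.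
by apply: leq_sum => q _; rewrite mulnCA leq_mul2l geq_minr orbT.
Qed.

(** The comparison is term by term. For a heavy [q], twice the weight of its subtree exceeds [w(H)],
    so its minimum is now [w(H)]. Afterwards it is at most [w(H) - m] if [q] survives, and the whole
    term disappears if [q] is in [S], a drop of [w(H) >= m]. The other terms cannot grow, as
    components only shrink. *)
Lemma potential_setD (D : tree T) (U H S : {set T}) (m : nat) (u : T) :
  u \in U -> H = component e U u -> S \subset H -> m <= sum_over w H ->
  (forall Y, connected e Y -> Y \subset H :\: S -> m + sum_over w Y <= sum_over w H) ->
  potential D (U :\: S) + sum_over c (heavy D H) * m <= potential D U.
Proof.
move=> uU HE SH mH mY.
have HU : H \subset U by rewrite HE component_sub.
have heavyU : heavy D H \subset U.
  by apply: subset_trans HU; apply/subsetP=> q; rewrite inE => /andP[].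
pose t (V : {set T}) q := c q * minn (sum_over w (component e V q)) (2 * sum_over w (subtree_set D q)).
have -> : potential D (U :\: S) = \sum_(q in U) (if q \in U :\: S then t (U :\: S) q else 0).
  rewrite -big_mkcondr; apply: eq_bigl => q; rewrite !inE.
  by case: (q \in U); rewrite ?andbF ?andbT.
have -> : sum_over c (heavy D H) * m = \sum_(q in U) (if q \in heavy D H then c q * m else 0).
  rewrite -big_mkcondr /sum_over big_distrl; apply: eq_bigl => q /=.
  by case qH: (q \in heavy D H); rewrite ?andbF ?(subsetP heavyU).
rewrite -big_split /=; apply: leq_sum => q qU.
have compH : q \in H -> component e U q = H.
  by move=> qH; apply: component_componentE => //; rewrite HE mem_components.
have sub : component e (U :\: S) q \subset component e U q by rewrite componentS ?subsetDl.
case: ifP => [qUS|qUS]; case: ifP => [|_]; rewrite ?addn0 //.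
- rewrite inE => /andP[qH heavy_q]; rewrite /t compH // -mulnDr leq_mul2l; apply/orP; right.
  have CH : component e (U :\: S) q \subset H :\: S.
    rewrite subsetD -{1}(compH qH) sub /=.
    apply/pred0P => y /=; apply/negbTE/negP => /andP[/(subsetP (component_sub _ _ _))].
    by rewrite inE => /andP[/negP yS _].
  have := mY _ (@component_connected _ _ e_sym (U :\: S) q) CH.
  have : sum_over w (subtree_set D q :&: H) <= sum_over w (subtree_set D q).
    by rewrite sum_overS ?subsetIl.
  move: heavy_q; lia.
- rewrite /t leq_mul2l; apply/orP; right.
  have := sum_overS w sub; lia.
- rewrite inE => /andP[qH heavy_q]; rewrite /t compH // add0n leq_mul2l; apply/orP; right.
  have : sum_over w (subtree_set D q :&: H) <= sum_over w (subtree_set D q).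
    by rewrite sum_overS ?subsetIl.
  move: heavy_q mH; lia.
Qed.

(** An amortized account: a bound on the cost of the vertices removed so far, plus [a] times the
    remaining potential, never exceeds [a] times the initial potential. [B] is chosen before [D], so
    one order serves against all decision trees. *)
Definition elimination_state (U : {set T}) (o : seq T) : Prop :=
  [/\ uniq o, forall v, (v \in o) = (v \notin U) &
  exists2 B, elimination_bound e B o & forall D, decision_tree e setT D ->
    ((\sum_(q in ~: U) c q * sum_over w (B q))%:R + a * (potential D U)%:R
       <= a * (potential D setT)%:R)%R].

Lemma elimination_bound_cat (B : T -> {set T}) (s o : seq T) :
  (forall v Y, v \in s -> connected e Y -> v \in Y -> {in Y, forall y, y \notin o} ->
     Y \subset B v) ->
  elimination_bound e B o -> elimination_bound e B (s ++ o).
Proof.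
move=> + Bo; elim: s => //= v s IHs Bs; split.
  move=> Y Yc vY Ys; apply: Bs; rewrite ?inE ?eqxx // => y yY.
  by have := Ys y yY; rewrite mem_cat => /norP[].
by apply: IHs => u Y us; apply: Bs; rewrite inE us orbT.
Qed.

Lemma eq_elimination_bound (B B' : T -> {set T}) (o : seq T) :
  {in o, B =1 B'} -> elimination_bound e B o -> elimination_bound e B' o.
Proof.
elim: o => //= v o IHo BB' [Bv Bo]; rewrite -BB' ?mem_head //; split=> //.
by apply: IHo => // u uo; apply: BB'; rewrite inE uo orbT.
Qed.

Lemma elimination_state0 : elimination_state setT [::].
Proof.
split=> // [v|]; first by rewrite !inE.
by exists (fun=> set0) => // D _; rewrite setCT big_set0 add0r.
Qed.

(** Every vertex of [S] gets the whole component as its bound, whatever the order inside [S].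
    Together they cost [c(S) w(H)], which [a] times the drop of the potential pays. They go in front
    of [o] because they are queried later. *)
Lemma elimination_state_cat (U S : {set T}) (o s : seq T) (u : T) :
  u \in U -> cheap_separator (component e U u) S -> uniq s -> s =i S ->
  elimination_state U o -> elimination_state (U :\: S) (s ++ o).
Proof.
set H := component e U u; move=> uU [SH _ cheap] us sS [uo oU [B Bo costB]].
have HU : H \subset U by rewrite component_sub.
have SU : S \subset U := subset_trans SH HU.
split.
- rewrite cat_uniq us uo andbT /=; apply/hasPn => v; rewrite oU /= sS.
  by apply: contra => /(subsetP SU).
- move=> v; rewrite mem_cat sS oU !inE negb_and negbK.
  by [].
exists (fun q => if q \in S then H else B q).
  apply: elimination_bound_cat => [v Y|].
    rewrite sS => vS Yc vY Yo; rewrite vS.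
    (* Avoiding [o] means staying in [U], so [Y] is confined to the component of [v] in [U], which
       is that of [u]. *)
    have YU : Y \subset U by apply/subsetP=> y /Yo; rewrite oU negbK.
    rewrite (_ : H = component e U v); first exact: connected_sub_component.
    by apply/esym/component_componentE; rewrite ?mem_components // (subsetP SH).
  apply: eq_elimination_bound Bo => q; rewrite oU.
  by case: ifP => // /(subsetP SU) ->.
move=> D dt; have [m [mH mY cm]] := cheap D dt.
have := @potential_setD D U H S m u uU (erefl H) SH mH mY.
set P' := potential D (U :\: S); set P := potential D U => PP'.
have -> : \sum_(q in ~: (U :\: S)) c q * sum_over w (if q \in S then H else B q)
  = sum_over c S * sum_over w H + \sum_(q in ~: U) c q * sum_over w (B q).
  rewrite (bigID (mem S)) /=; congr (_ + _).
    rewrite /sum_over big_distrl /=; apply: eq_big => [q|q /andP[_ ->] //].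
    by rewrite !inE; case: (q \in S) => //=; rewrite andbF.
  apply: eq_big => [q|q /andP[_ /negbTE->] //].
  rewrite !inE negb_and negbK; case qS: (q \in S) => //=; last by rewrite andbT.
  by rewrite (subsetP SU).
have {}PP' : (P'%:R + (sum_over c (heavy D H) * m)%:R <= P%:R :> R)%R.
  by rewrite -natrD ler_nat.
have := ler_wpM2l a_ge0 PP'; rewrite mulrDr natrD => PP.
apply: le_trans (costB D dt); rewrite -/P.
rewrite addrC addrA addrC lerD2l.
by apply: le_trans PP; rewrite lerD2l.
Qed.

Lemma elimination_state_cost (o : seq T) (x0 : T) (Dopt : tree T) :
  connected e setT -> elimination_state set0 o -> decision_tree e setT Dopt ->
  exists D, [/\ elimination_tree e o D, decision_tree e setT D &
    ((tree_cost c w D)%:R <= 2 * a * (tree_cost c w Dopt)%:R)%R].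
Proof.
move=> Tc [uo oT [B Bo costB]] dt0.
have [|D [De dt path]] := elimination_treeP e_sym x0 Tc uo _ Bo.
  by move=> v; rewrite oT inE.
exists D; split=> //.
apply: (@le_trans _ _ (\sum_(q in ~: set0) c q * sum_over w (B q))%:R)%R.
  rewrite ler_nat (tree_costE e_sym _ _ dt) [leqRHS](eq_bigl xpredT) => [|q]; last by rewrite setC0 inE.
  apply: leq_sum => q _; rewrite leq_mul2l sum_overS ?orbT //.
  by apply/subsetP => x; rewrite inE; apply: path.
(* With no vertex left the potential vanishes, and the account bounds the whole cost. *)
have := costB _ dt0; rewrite {1}/potential big_set0 mulr0 addr0 => /le_trans; apply.
rewrite (mulrC 2%R) -mulrA ler_wpM2l // -natrM ler_nat.
exact: potentialT.
Qed.

End EliminationCost.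

(** * Cuts *)

Section BalancedCut.
Variables (T : finType) (e : rel T) (w : T -> nat).
Hypothesis e_sym : symmetric e.

(** Let [W = w(H)]. Take for [A] a union of components of [H \ S] of maximal weight among those
    weighing at most [W / 2]. Then [B] with [S] weighs at least [W / 2]. If [A] with [S] weighed
    less than [W / 4], some component [Y] of positive weight would remain in [B]; by maximality it
    is no heavier than [A], so [A] with [Y] would weigh less than [W / 2], against the choice of
    [A]. The constant 8 is [4 * 2]. *)
Lemma balanced_cut (H S : {set T}) :
  S \subset H ->
  (forall Y, connected e Y -> Y \subset H :\: S -> 2 * sum_over w Y <= sum_over w H) ->
  exists A B : {set T},
    [/\ A :|: S :|: B = H, [disjoint A & S], [disjoint A & B], [disjoint S & B] &
      [/\ forall u v, u \in A -> v \in B -> ~~ e u v &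
        sum_over w H ^ 2 <= 8 * (sum_over w (A :|: S) * sum_over w (B :|: S))]].
Proof.
move=> SH small; set X := H :\: S.
pose closed (A : {set T}) := [forall u in A, forall v in X, e u v ==> (v \in A)].
have closedP A : reflect (closed_in e X A) (closed A).
  apply: (iffP forall_inP) => [Acl u v uA vX|Acl u uA].
    by move/forall_inP: (Acl u uA) => /(_ v vX)/implyP.
  by apply/forall_inP => v vX; apply/implyP; apply: Acl.
pose P (A : {set T}) := [&& A \subset X, closed A & 2 * sum_over w A <= sum_over w H].
have P0 : P set0.
  rewrite /P sub0set sum_over_set0 muln0 leq0n andbT; apply/closedP => u v.
  by rewrite inE.
case: (@arg_maxnP _ set0 P (sum_over w) P0) => A /and3P[AX /closedP Acl A2] Amax.
pose B := X :\: A.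
have AS : [disjoint A & S] by apply: disjointWl AX _; rewrite disjoint_sym disjoints_subset; apply/subsetP => x; rewrite !inE => ->.
have AB : [disjoint A & B] by rewrite disjoints_subset; apply/subsetP => x; rewrite !inE => ->.
have SB : [disjoint S & B] by rewrite disjoints_subset; apply/subsetP => x; rewrite !inE => ->; rewrite andbF.
have AH : A \subset H by apply: subset_trans AX (subsetDl _ _).
have HE : A :|: S :|: B = H.
  apply/setP=> x; rewrite !inE; have [/(subsetP AH)->//|xA /=] := boolP (x \in A).
  by have [/(subsetP SH)->|] := boolP (x \in S).
exists A, B; split=> //; split.
  move=> u v uA; rewrite !inE => /andP[vA /andP[vS vH]]; apply: contra vA => uv.
  by apply: (Acl u) => //; rewrite inE vS.
have wH : sum_over w A + sum_over w S + sum_over w B = sum_over w H.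
  rewrite -HE -!sum_overU // disjoint_sym disjoints_subset.
  apply/subsetP => x xB; rewrite !inE negb_or.
  by move: xB; rewrite !inE => /andP[-> /andP[->]].
have wAS := sum_overU w AS.
have wBS : sum_over w (B :|: S) = sum_over w B + sum_over w S.
  by rewrite sum_overU // disjoint_sym.
suff A4 : sum_over w H <= 4 * sum_over w (A :|: S).
  have : sum_over w H <= 2 * sum_over w (B :|: S) by lia.
  move: A4; move: (sum_over w H) (sum_over w (A :|: S)) (sum_over w (B :|: S)) => x y z xy xz.
  by have := leq_mul xy xz; rewrite mulnACA -mulnn.
have [B0|B0] := posnP (sum_over w B); first by lia.
have [y yB wy] : exists2 y, y \in B & 0 < w y.
  apply/exists_inP; rewrite -[X in is_true X]negbK; apply/negP => /exists_inPn wB.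
  move: B0; rewrite /sum_over big1 // => y yB.
  by have := wB y yB; rewrite -leqNgt leqn0 => /eqP.
have yX : y \in X by move: yB; rewrite inE => /andP[].
pose Y := component e X y.
have Yc : connected e Y by apply: component_connected.
have Y2 := small Y Yc (component_sub _ _ _).
have YX : closed_in e X Y by apply: component_closed.
have Ypos : 0 < sum_over w Y.
  apply: leq_trans wy _; rewrite /sum_over (bigD1 y) ?leq_addr //=.
  exact: mem_component.
have YA : [disjoint A & Y].
  rewrite disjoint_sym disjoints_subset; apply/subsetP => z zY; rewrite inE; apply/negP => zA.
  have := connected_sub_closed Yc (component_sub _ _ _) Acl zY zA.
  move/subsetP/(_ y (mem_component e yX)) => yA.
  by move: yB; rewrite inE yA.
have YAm : sum_over w Y <= sum_over w A.
  by apply: Amax; rewrite /P component_sub Y2 andbT; apply/closedP.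
have : ~~ P (A :|: Y).
  by apply/negP => /Amax; rewrite /= sum_overU // -[leqRHS]addn0 leq_add2l leqNgt Ypos.
rewrite /P subUset AX component_sub /= sum_overU //.
have -> : closed (A :|: Y).
  apply/closedP => u v /setUP[uA|uY] vX uv; apply/setUP; first by left; apply: Acl uv.
  by right; apply: YX uv.
rewrite /= wAS -ltnNge; move: YAm.
by move: (sum_over w A) (sum_over w S) (sum_over w Y) (sum_over w H) => x y' z t; clear; lia.
Qed.
End BalancedCut.

(** * Existence of optimal cuts and the sign of the approximation ratio *)

Section OptimalCut.
Variables (i : instance) (R : realFieldType).

(** Cuts are recoded as triples of sets, a finite type, so the minimal ratio is attained. *)
Lemma exists_optimal_cut (K0 : cut i) : is_cut K0 -> 0 < cut_denom K0 ->
  exists K : cut i, optimal_cut R K.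
Proof.
pose V := {set 'I_(nvert i)}.
pose cutof (t : V * V * V) := @Cut i t.1.1 t.1.2 t.2.
pose P (t : V * V * V) := let: (A, Z, B) := t in
  [&& A :|: Z :|: B == setT, [disjoint A & Z], [disjoint A & B], [disjoint Z & B],
     [forall u in A, forall v in B, ~~ edge u v] & 0 < cut_denom (cutof t)].
have PP t : P t <-> is_cut (cutof t) /\ 0 < cut_denom (cutof t).
  case: t => [[A S] B]; rewrite /P /is_cut /=; split.
    case/and5P=> /eqP-> -> -> -> /andP[/forall_inP AB ->]; split=> //; split=> // u v uA vB.
    by move/forall_inP: (AB u uA) => /(_ v vB).
  case=> [[-> -> -> -> AB] ->]; rewrite eqxx /= andbT.
  by apply/forall_inP => u uA; apply/forall_inP => v vB; apply: AB.
have cutofK (K : cut i) : cutof (sideA K, sep K, sideB K) = K by case: K.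
move=> K0c K0d; have P0 : P (sideA K0, sep K0, sideB K0) by apply/PP; rewrite cutofK.
case: (@arg_minP _ R _ _ P (fun t => cut_ratio R (cutof t)) P0) => t /PP[tc td] tmin.
by exists (cutof t); split=> // K' K'c K'd; rewrite -(cutofK K'); apply: tmin; apply/PP; rewrite cutofK.
Qed.

Lemma setT_connected : connected (@edge i) setT.
Proof.
move=> u v _ _; have := edge_conn u v; congr (is_true _).
by apply: eq_connect => x y; rewrite /induced /= !inE.
Qed.

(** In a connected graph an empty separator forces an empty side, and then a factor of the
    denominator is 0. *)
Lemma cut_sep_neq0 (K : cut i) : is_cut K -> 0 < cut_denom K -> sep K != set0.
Proof.
case: K => A S B [/= cover _ AB _ noedge]; rewrite /cut_denom /=.
case: eqVneq => // S0; rewrite S0 !setU0; case: (set_0Vmem A) => [->|[x xA]].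
  by rewrite sum_over_set0.
case: (set_0Vmem B) => [->|[y yB]]; first by rewrite sum_over_set0 muln0.
have Acl : closed_in (@edge i) setT A.
  move=> u v uA _ uv; have: v \in A :|: S :|: B by rewrite cover inE.
  rewrite S0 setU0 inE => /orP[//|vB]; by have := noedge u v uA vB; rewrite uv.
have := connected_sub_closed setT_connected (subsetT _) Acl (in_setT x) xA.
by move/subsetP/(_ y (in_setT y)) => yA; move/pred0P/(_ y): AB; rewrite /= yA yB.
Qed.
End OptimalCut.

Definition unit_instance (i : instance) : instance :=
  Instance (fun=> 1) (fun=> 1) (nvert_gt0 i) (@edge_sym i) (@edge_irr i) (@edge_conn i).

(** With unit costs and weights on the same graph the optimal ratio is positive, and [f (nvert i)]
    times it bounds a ratio that is at least 0. *)
Lemma approx_ratio_ge0 (R : realFieldType) (f : nat -> R) (i : instance) (K : cut (unit_instance i)) :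
  approx_cut f K -> (0 <= f (nvert i))%R.
Proof.
(* Taking all vertices as separator shows that a positive denominator occurs, hence that an optimal
   cut exists. *)
move=> [Kc Kf]; pose K0 := @Cut (unit_instance i) set0 setT set0.
have K0c : is_cut K0.
  by split=> /= [||||u v]; rewrite -?setI_eq0 ?set0I ?setI0 ?set0U ?setU0 // inE.
have K0d : 0 < cut_denom K0.
  rewrite /cut_denom /= set0U muln_gt0 andbb /sum_over sum1_card cardsT card_ord.
  exact: nvert_gt0.
have [K' K'opt] := exists_optimal_cut R K0c K0d.
have [Kd KK'] := Kf _ K'opt.
have [K'c K'd _] := K'opt.
have K'pos : (0 < cut_ratio R K')%R.
  rewrite /cut_ratio divr_gt0 ?ltr0n // /sum_over sum1_card card_gt0.
  exact: cut_sep_neq0.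
rewrite -(pmulr_lge0 _ K'pos); apply: le_trans KK'.
by rewrite /cut_ratio divr_ge0 ?ler0n.
Qed.

(** * A component as an instance on all vertices *)

Section RestrictedInstance.
Variables (i : instance) (H : {set 'I_(nvert i)}) (h : 'I_(nvert i)).
Hypotheses (hH : h \in H) (Hc : connected (@edge i) H).

Definition restrict_edge : rel 'I_(nvert i) :=
  [rel u v | [|| [&& u \in H, v \in H & edge u v],
                 (u == h) && (v \notin H) | (v == h) && (u \notin H)]].

Definition restrict_fun (g : 'I_(nvert i) -> nat) (v : 'I_(nvert i)) : nat :=
  if v \in H then g v else 0.

Lemma restrict_edge_sym : symmetric restrict_edge.
Proof.
move=> u v; rewrite /restrict_edge /= edge_sym andbCA; congr (_ || _).
exact: orbC.
Qed.

Lemma restrict_edge_irr : irreflexive restrict_edge.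
Proof.
move=> u; rewrite /restrict_edge /= edge_irr !andbF /= orbb.
by case: eqVneq => // ->; rewrite hH.
Qed.

Lemma restrict_edge_conn u v : connect restrict_edge u v.
Proof.
have toh x : connect restrict_edge x h.
  have [xH|xH] := boolP (x \in H); last first.
    by apply: connect1; rewrite /restrict_edge /= xH eqxx !orbT.
  apply: connect_sub (Hc xH hH) => y z yz; apply: connect1.
  by move: yz; rewrite /restrict_edge /induced /= => ->.
apply: connect_trans (toh u) _.
by rewrite (sym_connect_sym restrict_edge_sym) toh.
Qed.

(* The vertices outside H stay, as pendants at h without cost and weight, so that
   f is only used at [nvert i]: f need not be monotone. *)
Definition restrict_instance : instance :=
  Instance (restrict_fun (@cost i)) (restrict_fun (@weight i)) (nvert_gt0 i)
    restrict_edge_sym restrict_edge_irr restrict_edge_conn.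

Lemma sum_over_restrict (g : 'I_(nvert i) -> nat) (X : {set 'I_(nvert i)}) :
  sum_over (restrict_fun g) X = sum_over g (X :&: H).
Proof.
rewrite /sum_over /restrict_fun -big_mkcondr; apply: eq_bigl => v.
by rewrite inE.
Qed.

(** The default [[set h]] is taken only when the cut misses [H], which an approximate cut can do
    only if [H] has weight 0. It keeps the separator nonempty, so that each round removes a
    vertex. *)
Definition separator_of (K : cut restrict_instance) : {set 'I_(nvert i)} :=
  if [exists v, v \in sep K :&: H] then sep K :&: H else [set h].

(** The vertices outside [H] hang on [h], so they join the side of [h], or [A] if [h] is in [S].
    Having no weight, they leave the denominator unchanged. *)
Lemma extend_cut (A S B : {set 'I_(nvert i)}) :
  A :|: S :|: B = H -> [disjoint A & S] -> [disjoint A & B] -> [disjoint S & B] ->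
  (forall u v, u \in A -> v \in B -> ~~ edge u v) ->
  exists2 K : cut restrict_instance, is_cut K &
    sep K = S /\ cut_denom K = sum_over (@weight i) (A :|: S) * sum_over (@weight i) (B :|: S).
Proof.
move=> HE AS AB SB noedge.
have inH x : (x \in H) = [|| x \in A, x \in S | x \in B] by rewrite -HE !inE orbA.
pose A' := if h \in B then A else A :|: ~: H.
pose B' := if h \in B then B :|: ~: H else B.
have A'E x : (x \in A') = (x \in A) || (h \notin B) && (x \notin H).
  by rewrite /A'; case: ifP => _; rewrite ?inE /= ?orbF.
have B'E x : (x \in B') = (x \in B) || (h \in B) && (x \notin H).
  by rewrite /B'; case: ifP => _; rewrite ?inE /= ?orbF.
have disj (X Y : {set 'I_(nvert i)}) : [disjoint X & Y] -> forall x, x \in X -> x \in Y = false.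
  by move=> /pred0P XY x xX; have := XY x; rewrite /= xX.
exists (@Cut restrict_instance A' S B').
  split=> /=.
  - by apply/setP=> x; rewrite 2!inE A'E B'E inH !inE; case: (x \in A); case: (x \in S); case: (x \in B); case: (h \in B).
  - apply/pred0P => x /=; rewrite A'E inH; apply/negbTE/negP => /andP[/orP[xA|/andP[_ /norP[_ /norP[xS _]]]]].
      by rewrite (disj _ _ AS).
    by rewrite (negPf xS).
  - apply/pred0P => x /=; rewrite A'E B'E inH; have := disj _ _ AB x.
    by case: (x \in A); case: (x \in S); case: (x \in B); case: (h \in B) => //= /(_ isT).
  - apply/pred0P => x /=; rewrite B'E inH; have := disj _ _ SB x.
    by case: (x \in A); case: (x \in S); case: (x \in B); case: (h \in B) => //= /(_ isT).
  - move=> u v; rewrite A'E B'E => uA vB; apply/negP; rewrite /restrict_edge /=.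
    case/or3P => [/and3P[uH vH uv]|/andP[/eqP uh vH]|/andP[/eqP vh uH]].
    + move: uA vB; rewrite uH vH !andbF !orbF => uA vB.
      by have := noedge u v uA vB; rewrite uv.
    + move: uA vB; rewrite uh hH /= andbF orbF => hA.
      rewrite (disj _ _ AB _ hA) /= orbF => vB; move: vH; rewrite inH vB !orbT //.
    + move: uA vB; rewrite vh hH /= andbF orbF => + hB.
      by rewrite hB /= orbF => uA; move: uH; rewrite inH uA.
split=> //; rewrite /cut_denom /= !sum_over_restrict.
have -> : (A' :|: S) :&: H = A :|: S.
  apply/setP=> x; have := disj _ _ AB x; have := disj _ _ SB x.
  rewrite 2!inE A'E inH !inE.
  by case: (x \in A); case: (x \in S); case: (x \in B); case: (h \in B) => //= H1 H2; rewrite ?H1 ?H2.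
have -> // : (B' :|: S) :&: H = B :|: S.
apply/setP=> x; rewrite 2!inE B'E inH !inE.
by case: (x \in A); case: (x \in S); case: (x \in B); case: (h \in B).
Qed.

Variables (R : realFieldType) (f : nat -> R).
Hypothesis f_ge0 : (0 <= f (nvert i))%R.

(** Let [x], [y] be the factors of the denominator of [K] and [W = w(H)]. Comparison with the cut
    made from the heavy set gives [c(S) W^2 <= 8 f c(heavy) x y], and [x y <= W min(x, y)] removes
    one factor [W]. A component of [H \ S] lies on one side and misses the opposite factor, hence
    [m = min(x, y)]. *)
Lemma approx_cut_cheap (K : cut restrict_instance) :
  approx_cut f K ->
  cheap_separator (@edge i) (@cost i) (@weight i) (8 * f (nvert i))%R H (separator_of K).
Proof.
move=> [Kc Kf]; set w := @weight i; set c := @cost i; set S := separator_of K.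
have SH : S \subset H.
  rewrite /S /separator_of; case: ifP => _; first exact: subsetIr.
  by rewrite sub1set.
have S0 : S != set0.
  rewrite /S /separator_of; case: ifP => [/existsP[v vS]|_]; apply/set0Pn; first by exists v.
  by exists h; rewrite inE.
split=> // D dt.
(* If [H] has no weight the cut may be arbitrary, but with [m = 0] both sides of the estimate
   vanish. *)
have [W0|W0] := posnP (sum_over w H).
  exists 0; rewrite W0; split=> //.
    by move=> Y _ YS; rewrite add0n -W0 sum_overS // (subset_trans YS) ?subsetDl.
  by rewrite !muln0 mulr0.
have [K' [K'c [K'w K'S]]] : exists K', is_cut K' /\ 
  sum_over w H ^ 2 <= 8 * cut_denom K' /\ sum_over (@cost restrict_instance) (sep K') = sum_over c (heavy w D H).
  (* The first query of [D] inside [Y] has all of [Y] in its subtree; not being heavy, it bounds the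
     weight of [Y]. *)
  have small Y : connected (@edge i) Y -> Y \subset H :\: heavy w D H ->
      2 * sum_over w Y <= sum_over w H.
    move=> Yc YH; have [->|[y yY]] := set_0Vmem Y; first by rewrite sum_over_set0.
    have [v vY vP] := connected_dominated (@edge_sym i) dt Yc (subsetT _) yY.
    have := subsetP YH _ vY; rewrite !inE => /andP[+ vH]; rewrite vH /= -leqNgt.
    apply: leq_trans; rewrite leq_mul2l; apply: sum_overS; apply/subsetP => x xY.
    by rewrite !inE vP //; have := subsetP YH _ xY; rewrite inE => /andP[].
  have hvH : heavy w D H \subset H by apply/subsetP => x; rewrite inE => /andP[].
  have [A [B [HE AS AB SB [noedge bal]]]] := balanced_cut (@edge_sym i) hvH small.
  have [K' K'c [K'S K'd]] := extend_cut HE AS AB SB noedge.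
  exists K'; split=> //; split; first by rewrite K'd.
  by rewrite K'S sum_over_restrict (setIidPl hvH).
have K'd : 0 < cut_denom K'.
  by rewrite lt0n; apply: contraTneq K'w => ->; rewrite muln0 leqn0 expn_eq0 andbT -lt0n.
have [K0 K0opt] : exists K0 : cut restrict_instance, optimal_cut R K0.
  exact: (exists_optimal_cut R K'c).
have [Kd KK0] := Kf _ K0opt.
have K0K' : (cut_ratio R K0 <= cut_ratio R K')%R by case: K0opt => _ _; apply.
have ratio : (cut_ratio R K <= f (nvert i) * cut_ratio R K')%R.
  by apply: le_trans KK0 _; apply: ler_wpM2l.
have [_ AS AB SB noedge] := Kc.
set A := sideA K in AS AB noedge; set B := sideB K in AB SB noedge.
have cover x : x \in H -> [|| x \in A, x \in sep K | x \in B].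
  by have [/setP/(_ x) + _ _ _ _ _] := Kc; rewrite !inE orbA => ->.
have noedgeH u v : u \in H -> v \in H -> u \in A -> v \in B -> ~~ edge u v.
  move=> uH vH uA vB; apply: contra (noedge u v uA vB) => uv.
  by rewrite /edge /= /restrict_edge /= uH vH uv.
have denomE : cut_denom K = sum_over w ((A :|: sep K) :&: H) * sum_over w ((B :|: sep K) :&: H).
  by rewrite /cut_denom /= !sum_over_restrict.
have sides (Y : {set 'I_(nvert i)}) : connected (@edge i) Y -> Y \subset H ->
    [disjoint Y & sep K] -> Y \subset A \/ Y \subset B.
  move=> Yc YH /pred0P YS; have [->|[y yY]] := set_0Vmem Y; first by left; apply: sub0set.
  have YnS v : v \in Y -> v \notin sep K by move=> vY; apply/negP => vS; have := YS v; rewrite /= vY vS.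
  have := cover y (subsetP YH _ yY); rewrite (negPf (YnS y yY)) /= => /orP[yA|yB]; [left|right].
    apply: subset_trans (subsetIl A H); apply: (connected_sub_closed Yc (subxx Y) _ yY).
      move=> u v /setIP[uA uH] vY uv; have vH := subsetP YH v vY; rewrite inE vH andbT.
      have := cover v vH; rewrite (negPf (YnS v vY)) => /orP[//|vB].
      by have := noedgeH u v uH vH uA vB; rewrite uv.
    by rewrite inE yA (subsetP YH).
  apply: subset_trans (subsetIl B H); apply: (connected_sub_closed Yc (subxx Y) _ yY).
    move=> u v /setIP[uB uH] vY uv; have vH := subsetP YH v vY; rewrite inE vH andbT.
    have := cover v vH; rewrite (negPf (YnS v vY)) => /orP[vA|//].
    by have := noedgeH v u vH uH vA uB; rewrite edge_sym uv.
  by rewrite inE yB (subsetP YH).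
(* If [K] missed [H], the connected set [H] would lie on one side and the other factor of the
   denominator would be 0. *)
have SE : S = sep K :&: H.
  rewrite /S /separator_of; case: existsP => // nS.
  have HS : [disjoint H & sep K].
    by apply/pred0P => v /=; apply/negP => /andP[vH vS]; apply: nS; exists v; rewrite inE vS.
  move: Kd; rewrite denomE muln_gt0; have [HA|HB] := sides H Hc (subxx _) HS.
    rewrite (_ : (B :|: sep K) :&: H = set0) ?sum_over_set0 ?andbF //.
    apply/setP=> v; rewrite !inE; apply/negP => /andP[/orP[vB|vS] vH].
      by have := pred0P AB v; rewrite /= vB (subsetP HA).
    by have := pred0P HS v; rewrite /= vS vH.
  rewrite (_ : (A :|: sep K) :&: H = set0) ?sum_over_set0 ?andbF //.
  apply/setP=> v; rewrite !inE; apply/negP => /andP[/orP[vA|vS] vH].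
    by have := pred0P AB v; rewrite /= vA (subsetP HB).
  by have := pred0P HS v; rewrite /= vS vH.
set x := sum_over w ((A :|: sep K) :&: H) in denomE *.
set y := sum_over w ((B :|: sep K) :&: H) in denomE *.
have xH : x <= sum_over w H by apply: sum_overS; apply: subsetIr.
have yH : y <= sum_over w H by apply: sum_overS; apply: subsetIr.
exists (minn x y); split.
- by rewrite geq_min xH.
- move=> Y Yc YHS.
  have YH : Y \subset H := subset_trans YHS (subsetDl _ _).
  have YS : [disjoint Y & sep K].
    apply/pred0P => v /=; apply/negP => /andP[vY vS]; have := subsetP YHS v vY.
    by rewrite SE !inE vS /=; case: (v \in H).
  have [YA|YB] := sides Y Yc YH YS.
    apply: (@leq_trans (y + sum_over w Y)); first by rewrite leq_add2r geq_minr.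
    apply: sum_over_disjoint_leq => //; first exact: subsetIr.
    apply/pred0P => v /=; apply/negP => /andP[+ vY]; rewrite !inE => /andP[/orP[vB|vS] _].
      by have := pred0P AB v; rewrite /= vB (subsetP YA).
    by have := pred0P YS v; rewrite /= vS vY.
  apply: (@leq_trans (x + sum_over w Y)); first by rewrite leq_add2r geq_minl.
  apply: sum_over_disjoint_leq => //; first exact: subsetIr.
  apply/pred0P => v /=; apply/negP => /andP[+ vY]; rewrite !inE => /andP[/orP[vA|vS] _].
    by have := pred0P AB v; rewrite /= vA (subsetP YB).
  by have := pred0P YS v; rewrite /= vS vY.
move: ratio; rewrite /cut_ratio K'S sum_over_restrict -/c -SE => ratio.
have {K'd} d'0 : (0 < (cut_denom K')%:R :> R)%R by rewrite ltr0n.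
have d0 : (0 < (cut_denom K)%:R :> R)%R by rewrite ltr0n.
move: ratio; rewrite [leRHS]mulrA ler_pdivrMr // [leRHS]mulrAC ler_pdivlMr // => ratio.
set cS := sum_over c S in ratio *; set cO := sum_over c _ in ratio *.
set W := sum_over w H in W0 K'w xH yH *.
have xyW : x * y <= W * minn x y.
  by have [xy|yx] := leqP x y; [rewrite mulnC leq_mul2r yH orbT | rewrite leq_mul2r xH orbT].
have W0' : (0 < W%:R :> R)%R by rewrite ltr0n.
rewrite -(ler_pM2r W0'); apply: (@le_trans _ _ (8 * (cS%:R * (cut_denom K')%:R)))%R.
  by rewrite -!natrM ler_nat -mulnA mulnn mulnCA leq_mul2l K'w orbT.
rewrite -!mulrA ler_wpM2l //; apply: le_trans ratio _.
rewrite -!mulrA ler_wpM2l // -!natrM ler_nat denomE -mulnA leq_mul2l.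
by rewrite [minn x y * W]mulnC xyW orbT.
Qed.
End RestrictedInstance.

(** * Polynomial-time functions on data *)

Section Evaluation.

Lemma dsize_gt0 x : 0 < dsize x. Proof. by case: x. Qed.

Lemma dsize_dhd x : dsize (dhd x) <= dsize x.
Proof. by case: x => //= y z; rewrite ltnW // ltnS leq_addr. Qed.

Lemma dsize_dtl x : dsize (dtl x) <= dsize x.
Proof. by case: x => //= y z; rewrite ltnW // ltnS leq_addl. Qed.

(** The charge per node pays for the output as it is built. Hence time bounds double as size bounds,
    which composition relies on. *)
Lemma eval_dsize p x y t : eval p x y t -> dsize y <= t.
Proof.
elim=> {p x y t} //=; try by move=> *; rewrite ?dsize_gt0 ?dsize_dhd ?dsize_dtl.
- move=> p q x y z s t _ ys _ zt; rewrite -addnS -addnA.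
  have := dsize_gt0 x; lia.
- by move=> p q x y z s t _ _ _ zt; apply: leq_trans zt (leq_addl _ _).
- by move=> p q x y t _ _ yt; apply: leq_trans yt (leq_addl _ _).
- by move=> p q x y t _ _ yt; apply: leq_trans yt (leq_addl _ _).
- by move=> p x y z s t _ _ _ _ zt; apply: leq_trans zt (leq_addl _ _).
Qed.

(** Determinism identifies an output chosen by [epsilon] with the one that the specification
    provides. *)
Lemma eval_det p x y t : eval p x y t -> forall y' t', eval p x y' t' -> y = y'.
Proof.
elim=> {p x y t}; intros;
  match goal with E : eval _ _ ?z _ |- _ = ?z => inversion E; subst end;
  repeat match goal with
    IH : forall y' t', eval ?p ?x y' t' -> _ = y', E : eval ?p ?x _ _ |- _ =>
      have ? := IH _ _ E; subst; clear E
  end; by [].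
Qed.

End Evaluation.

Lemma leq_expl m n k : m <= n -> m ^ k <= n ^ k.
Proof. by case: k => // k mn; rewrite leq_exp2r. Qed.

Section PolynomialBounds.

Definition poly_bounded (P : data -> Prop) (s : data -> nat) : Prop :=
  exists a k, forall x, P x -> s x <= a * dsize x ^ k.

Lemma poly_bounded_leq (P : data -> Prop) (s s' : data -> nat) :
  (forall x, P x -> s x <= s' x) -> poly_bounded P s' -> poly_bounded P s.
Proof. by move=> ss' [a [k s'k]]; exists a, k => x Px; apply: leq_trans (ss' x Px) (s'k x Px). Qed.

Lemma poly_bounded_cst (P : data -> Prop) n : poly_bounded P (fun=> n).
Proof. by exists n, 0 => x _; rewrite expn0 muln1. Qed.

Lemma poly_bounded_dsize (P : data -> Prop) : poly_bounded P dsize.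
Proof. by exists 1, 1 => x _; rewrite mul1n expn1. Qed.

Lemma leq_pow_dsize x a k b j :
  a <= b -> k <= j -> a * dsize x ^ k <= b * dsize x ^ j.
Proof. by move=> ab kj; rewrite leq_mul // leq_pexp2l // dsize_gt0. Qed.

Lemma poly_bounded_add (P : data -> Prop) (s s' : data -> nat) :
  poly_bounded P s -> poly_bounded P s' -> poly_bounded P (fun x => s x + s' x).
Proof.
move=> [a [k sk]] [b [j s'j]]; exists (a + b), (k + j) => x Px.
rewrite mulnDl leq_add //.
  by apply: leq_trans (sk x Px) _; apply: leq_pow_dsize; rewrite ?leq_addr.
by apply: leq_trans (s'j x Px) _; apply: leq_pow_dsize; rewrite ?leq_addl.
Qed.

Lemma poly_bounded_mul (P : data -> Prop) (s s' : data -> nat) :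
  poly_bounded P s -> poly_bounded P s' -> poly_bounded P (fun x => s x * s' x).
Proof.
move=> [a [k sk]] [b [j s'j]]; exists (a * b), (k + j) => x Px.
by rewrite expnD mulnACA leq_mul ?sk ?s'j.
Qed.

Lemma poly_bounded_exp (P : data -> Prop) (s : data -> nat) k :
  poly_bounded P s -> poly_bounded P (fun x => s x ^ k).
Proof.
move=> sP; elim: k => [|k IHk]; first exact: poly_bounded_cst.
by apply: poly_bounded_leq (poly_bounded_mul sP IHk) => x _; rewrite expnS.
Qed.

Lemma poly_bounded_comp (P Q : data -> Prop) (f : data -> data) (s : data -> nat) :
  (forall x, P x -> Q (f x)) -> poly_bounded P (dsize \o f) -> poly_bounded Q s ->
  poly_bounded P (s \o f).
Proof.
move=> PQ fP [a [k sk]].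
apply: poly_bounded_leq (poly_bounded_mul (poly_bounded_cst P a) (poly_bounded_exp k fP)).
by move=> x Px; apply/sk/PQ.
Qed.

End PolynomialBounds.

Section PolynomialTime.

(** The domain [P] is there for the given cut program, known to halt only on encodings of
    instances. *)
Definition polytime (P : data -> Prop) (f : data -> data) : Prop :=
  exists p s, poly_bounded P s /\
    forall x, P x -> exists2 t, eval p x (f x) t & t <= s x.

Implicit Types (P Q : data -> Prop) (f g : data -> data).

Lemma polytime_dsize P f : polytime P f -> poly_bounded P (dsize \o f).
Proof.
move=> [p [s [sP ps]]]; apply: poly_bounded_leq sP => x Px.
by have [t /eval_dsize + ts] := ps x Px; move/leq_trans; apply.
Qed.

Lemma polytime_sub P Q f : (forall x, P x -> Q x) -> polytime Q f -> polytime P f.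
Proof.
move=> PQ [p [s [[a [k sk]] ps]]]; exists p, s; split=> [|x Px]; last exact: ps (PQ x Px).
by exists a, k => x Px; apply/sk/PQ.
Qed.

Lemma eq_polytime P f g : (forall x, P x -> f x = g x) -> polytime P f -> polytime P g.
Proof.
move=> fg [p [s [sP ps]]]; exists p, s; split=> // x Px.
by rewrite -fg //; apply: ps.
Qed.

Lemma polytime_id P : polytime P id.
Proof.
by exists pId, dsize; split=> [|x _]; [apply: poly_bounded_dsize | exists (dsize x) => //; constructor].
Qed.

Lemma polytime_comp P Q f g : (forall x, P x -> Q (f x)) ->
  polytime P f -> polytime Q g -> polytime P (fun x => g (f x)).
Proof.
move=> PQ fP [q [s' [s'Q qs']]]; have fs := polytime_dsize fP.
case: fP => p [s [sP ps]].
exists (pSeq p q), (fun x => s x + s' (f x)); split=> [|x Px].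
  by apply: poly_bounded_add => //; apply: poly_bounded_comp fs s'Q.
have [t pt ts] := ps x Px; have [u qu us'] := qs' _ (PQ x Px).
by exists (t + u); [exact: eval_seq pt qu | exact: leq_add].
Qed.

Lemma polytime_dhd P f : polytime P f -> polytime P (fun x => dhd (f x)).
Proof.
move=> fP; apply: (@polytime_comp P xpredT) fP _ => //.
by exists pHd, dsize; split=> [|x _]; [apply: poly_bounded_dsize | exists (dsize x) => //; constructor].
Qed.

Lemma polytime_dtl P f : polytime P f -> polytime P (fun x => dtl (f x)).
Proof.
move=> fP; apply: (@polytime_comp P xpredT) fP _ => //.
by exists pTl, dsize; split=> [|x _]; [apply: poly_bounded_dsize | exists (dsize x) => //; constructor].
Qed.

Lemma polytime_dcons P f g : polytime P f -> polytime P g ->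
  polytime P (fun x => dcons (f x) (g x)).
Proof.
move=> [p [s [sP ps]]] [q [s' [s'P qs']]].
exists (pPair p q), (fun x => dsize x + s x + s' x); split=> [|x Px].
  by apply: poly_bounded_add => //; apply: poly_bounded_add => //; apply: poly_bounded_dsize.
have [t pt ts] := ps x Px; have [u qu us'] := qs' x Px.
by exists (dsize x + t + u); [exact: eval_pair pt qu | rewrite leq_add ?leq_add2l].
Qed.

Lemma polytime_cst P (y : data) : polytime P (fun=> y).
Proof.
elim: y => [|y IHy z IHz]; last exact: polytime_dcons.
by exists pNil, dsize; split=> [|x _]; [apply: poly_bounded_dsize | exists (dsize x) => //; constructor].
Qed.

Definition truth (x : data) : bool := if x is dcons _ _ then true else false.

Lemma truth_enc_bool b : truth (enc_bool b) = b. Proof. by case: b. Qed.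

(** Each branch has to be polynomial only where the test leads to it; elsewhere its bound is
    replaced by 0. *)
Lemma polytime_if P (b f g : data -> data) :
  polytime P b -> polytime (fun x => P x /\ truth (b x)) f ->
  polytime (fun x => P x /\ ~~ truth (b x)) g ->
  polytime P (fun x => if truth (b x) then f x else g x).
Proof.
move=> [r [u [uP ru]]] [p [s [sP ps]]] [q [s' [s'P qs']]].
(* The test result is paired with [x], since [pIf] inspects the head of the register; each branch
   first recovers [x] with [pTl]. *)
exists (pSeq (pPair r pId) (pIf (pSeq pTl p) (pSeq pTl q))).
exists (fun x => (dsize x + u x + dsize x) + ((u x + dsize x).+1 + ((u x + dsize x).+1 +
   ((if truth (b x) then s x else 0) + (if truth (b x) then 0 else s' x))))); split.
  have uD : poly_bounded P (fun x => (u x + dsize x).+1).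
    apply: (@poly_bounded_leq _ _ (fun x => 1 + (u x + dsize x))) => //.
    apply: poly_bounded_add (poly_bounded_cst _ _) _.
    exact: poly_bounded_add (poly_bounded_dsize _).
  apply: poly_bounded_add.
    apply: poly_bounded_add (poly_bounded_dsize _).
    exact: poly_bounded_add (poly_bounded_dsize _) _.
  do 2![apply: poly_bounded_add => //]; apply: poly_bounded_add.
    case: sP => a [k sk]; exists a, k => x Px; case: ifP => // bx.
    exact: sk.
  case: s'P => a [k sk]; exists a, k => x Px; case: ifPn => // bx.
  exact: sk.
move=> x Px; have [t rt tu] := ru x Px.
have bu : dsize (b x) <= u x := leq_trans (eval_dsize rt) tu.
have E := eval_pair rt (eval_id x).
have sz : dsize (dcons (b x) x) <= (u x + dsize x).+1 by rewrite /= ltnS leq_add2r.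
case: ifPn => bx; [have [v fv vs] := ps x (conj Px bx) | have [v fv vs] := qs' x (conj Px bx)].
  eexists.
    apply: eval_seq E _; apply: eval_ift; first by case: (b x) bx.
    by apply: eval_seq fv; apply: eval_tl.
  rewrite addn0; apply: leq_add; first by rewrite leq_add2r leq_add2l.
  by apply: leq_add => //; apply: leq_add.
eexists.
  apply: eval_seq E _; apply: eval_iff; first by case: (b x) bx.
  by apply: eval_seq fv; apply: eval_tl.
rewrite add0n; apply: leq_add; first by rewrite leq_add2r leq_add2l.
by apply: leq_add => //; apply: leq_add.
Qed.

Fixpoint items (x : data) : seq data := if x is dcons a y then a :: items y else [::].

Lemma items_enc_seq s : items (enc_seq s) = s.
Proof. by elim: s => //= a s ->. Qed.

Lemma size_items x : size (items x) < dsize x.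
Proof. by elim: x => //= a _ y IHy; rewrite ltnS (leq_trans IHy) // leq_addl. Qed.

(* A loop runs in polynomial time when one turn enlarges the accumulator by an
   amount that does not depend on the accumulator. *)
Lemma polytime_foldl P (I : data -> data -> Prop) (L init : data -> data)
    (step : data -> data -> data -> data) (d : data -> nat) :
  polytime P L -> polytime P init ->
  (forall x, P x -> I x (init x)) ->
  (forall x a acc, P x -> I x acc -> I x (step x acc a)) ->
  polytime (fun z => P (dtl (dtl z)) /\ I (dtl (dtl z)) (dhd (dtl z)))
    (fun z => step (dtl (dtl z)) (dhd (dtl z)) (dhd z)) ->
  poly_bounded (fun z => P (dtl z)) d ->
  (forall x a acc, P x -> I x acc -> dsize (step x acc a) <= dsize acc + d (dcons a x)) ->
  polytime P (fun x => foldl (step x) (init x) (items (L x))).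
Proof.
move=> LP iP Ii Is [p [s [[a0 [k0 sk]] ps]]] [a1 [k1 dk]] grow.
(* [D] bounds the growth in one turn, [M] the accumulator at any time, [N] the register, and [B] the
   time of one turn: copying, with a generous constant 20, plus one run of [p]. *)
pose D x := a1 * (dsize (L x) + dsize x).+1 ^ k1.
pose M x := dsize (init x) + dsize (L x) * D x.
pose N x := (dsize (L x) + (M x + dsize x)).+2.
pose B x := 20 * N x + a0 * N x ^ k0.
have LD := polytime_dsize LP; have iD := polytime_dsize iP.
have PD := poly_bounded_dsize P.
have pS u : poly_bounded P u -> poly_bounded P (fun x => (u x).+1).
  by move=> uP; apply: (poly_bounded_add (poly_bounded_cst P 1) uP).
have DP : poly_bounded P D.
  apply: poly_bounded_mul (poly_bounded_cst _ _) _; apply: poly_bounded_exp.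
  by apply: pS; apply: poly_bounded_add.
have MP : poly_bounded P M by apply: poly_bounded_add => //; apply: poly_bounded_mul.
have NP : poly_bounded P N.
  by do 2!apply/pS; apply: poly_bounded_add => //; apply: poly_bounded_add.
have BP : poly_bounded P B.
  apply: poly_bounded_add; apply: poly_bounded_mul (poly_bounded_cst _ _) _ => //.
  exact: poly_bounded_exp.
(* The register holds the remaining list, the accumulator and [x]; the list is in front because
   [pWhile] tests the head. *)
pose body := pPair (pSeq pHd pTl) (pPair (pSeq (pPair (pSeq pHd pHd) pTl) p) (pSeq pTl pTl)).
case: LP => pL [sL [sLP pLs]]; case: iP => pi [si [siP pis]].
exists (pSeq (pPair pL (pPair pi pId)) (pSeq (pWhile body) (pSeq pTl pHd))).
exists (fun x => (dsize x + sL x + (dsize x + si x + dsize x)) + ((dsize (L x)).+1 * B x + 2 * N x)).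
split.
  apply: poly_bounded_add.
    apply: poly_bounded_add; first exact: poly_bounded_add.
    by apply: poly_bounded_add => //; apply: poly_bounded_add.
  apply: poly_bounded_add; last by apply: poly_bounded_mul => //; apply: poly_bounded_cst.
  by apply: poly_bounded_mul => //; apply: pS.
move=> x Px.
(* Invariant: the accumulator plus an allowance [D x] for each remaining item stays below [M x]. *)
have loop l acc : I x acc -> dsize acc + size (items l) * D x <= M x -> dsize l <= dsize (L x) ->
    exists2 t, eval (pWhile body) (dcons l (dcons acc x))
       (dcons dnil (dcons (foldl (step x) acc (items l)) x)) t
     & t <= (size (items l)).+1 * B x /\ dsize (foldl (step x) acc (items l)) <= M x.
  elim: l acc => [|a _ l IHl] acc Iacc accM lL.
    exists (dsize (dcons dnil (dcons acc x))); first by apply: eval_while_stop.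
    split; last by move: accM; rewrite mul0n addn0.
    rewrite mul1n /B /= ; move: accM; rewrite mul0n addn0 /N; lia.
  have sa : dsize (step x acc a) <= dsize acc + D x.
    apply: leq_trans (grow x a acc Px Iacc) _; rewrite leq_add2l.
    apply: leq_trans (dk (dcons a x) Px) _; rewrite leq_mul2l; apply/orP; right.
    by apply: leq_expl; move: lL => /=; lia.
  move: accM; rewrite [size _]/= mulSn addnA => accM.
  have [||t evt [tB fM]] := IHl (step x acc a) (Is _ _ _ Px Iacc).
  - by apply: leq_trans accM; rewrite leq_add2r.
  - by apply: leq_trans lL; rewrite /= ltnW // ltnS leq_addl.
  have aM : dsize acc <= M x by apply: leq_trans accM; rewrite -addnA leq_addr.
  have sM : dsize (step x acc a) <= M x.
    by apply: leq_trans accM; apply: leq_trans sa _; rewrite leq_addr.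
  have [|u pu us] := ps (dcons a (dcons acc x)); first by split.
  have uN : u <= a0 * N x ^ k0.
    apply: leq_trans us _; apply: leq_trans (sk _ _) _; first by split.
    rewrite leq_mul2l; apply/orP; right; apply: leq_expl.
    move: lL; rewrite /N /=; lia.
  have z0 : dhd (dcons (dcons a l) (dcons acc x)) <> dnil by [].
  have pop := eval_seq (eval_hd (dcons (dcons a l) (dcons acc x))) (eval_tl _).
  have arg := eval_pair (eval_seq (eval_hd (dcons (dcons a l) (dcons acc x))) (eval_hd _)) (eval_tl _).
  have env := eval_seq (eval_tl (dcons (dcons a l) (dcons acc x))) (eval_tl _).
  have turn := eval_while_step z0 (eval_pair pop (eval_pair (eval_seq arg pu) env)) evt.
  eexists; first exact: turn.
  split=> //; rewrite mulSn /= leq_add //.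
  rewrite /B; move: uN lL; rewrite /N /=; lia.
have [t pt ts] := pLs x Px; have [u pu us] := pis x Px.
have [|||v pv [vB fM]] := loop (L x) (init x); first exact: Ii.
- by rewrite leq_add2l leq_mul2r ltnW ?orbT // size_items.
- by [].
eexists.
  apply: eval_seq; first by apply: eval_pair pt (eval_pair pu (eval_id x)).
  by apply: eval_seq pv (eval_seq (eval_tl _) (eval_hd _)).
apply: leq_add; first by rewrite leq_add ?leq_add2l // leq_add2r leq_add2l.
apply: leq_add; first by apply: leq_trans vB _; rewrite leq_mul2r ltnS ltnW ?orbT // size_items.
rewrite /N /=; lia.
Qed.

End PolynomialTime.

(** * Polynomial-time list operations *)

Section ListPrograms.
Implicit Types (P : data -> Prop) (L f g : data -> data).

Lemma enc_seq_items x : enc_seq (items x) = x.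
Proof. by elim: x => //= a _ y ->. Qed.

Lemma polytime_ifb P (b : data -> bool) f g :
  polytime P (fun x => enc_bool (b x)) ->
  polytime (fun x => P x /\ b x) f -> polytime (fun x => P x /\ ~~ b x) g ->
  polytime P (fun x => if b x then f x else g x).
Proof.
move=> bP fP gP; apply: (@eq_polytime P (fun x => if truth (enc_bool (b x)) then f x else g x)).
  by move=> x _; rewrite truth_enc_bool.
apply: polytime_if => //.
  by apply: polytime_sub fP => x; rewrite truth_enc_bool.
by apply: polytime_sub gP => x; rewrite truth_enc_bool.
Qed.

Lemma polytime_if_total P (b : data -> bool) f g :
  polytime P (fun x => enc_bool (b x)) -> polytime P f -> polytime P g ->
  polytime P (fun x => if b x then f x else g x).
Proof.
by move=> bP fP gP; apply: polytime_ifb => //; [apply: polytime_sub fP | apply: polytime_sub gP];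
  move=> x [].
Qed.

Lemma polytime_truth P f : polytime P f -> polytime P (fun x => enc_bool (truth (f x))).
Proof.
move=> fP; apply: (@eq_polytime P (fun x => if truth (f x) then dcons dnil dnil else dnil)).
  by move=> x _; case: truth.
by apply: polytime_if => //; apply: polytime_cst.
Qed.

Lemma polytime_negb P (b : data -> bool) :
  polytime P (fun x => enc_bool (b x)) -> polytime P (fun x => enc_bool (~~ b x)).
Proof.
move=> bP; apply: (@eq_polytime P (fun x => if b x then dnil else dcons dnil dnil)).
  by move=> x _; case: (b x).
by apply: polytime_if_total => //; apply: polytime_cst.
Qed.

Lemma polytime_andb P (b b' : data -> bool) :
  polytime P (fun x => enc_bool (b x)) -> polytime P (fun x => enc_bool (b' x)) ->
  polytime P (fun x => enc_bool (b x && b' x)).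
Proof.
move=> bP b'P; apply: (@eq_polytime P (fun x => if b x then enc_bool (b' x) else dnil)).
  by move=> x _; case: (b x).
by apply: polytime_if_total => //; apply: polytime_cst.
Qed.

Lemma polytime_orb P (b b' : data -> bool) :
  polytime P (fun x => enc_bool (b x)) -> polytime P (fun x => enc_bool (b' x)) ->
  polytime P (fun x => enc_bool (b x || b' x)).
Proof.
move=> bP b'P; apply: (@eq_polytime P (fun x => if b x then dcons dnil dnil else enc_bool (b' x))).
  by move=> x _; case: (b x).
by apply: polytime_if_total => //; apply: polytime_cst.
Qed.

Lemma polytime_foldl_total P L (init : data -> data) (step : data -> data -> data -> data)
    (d : data -> nat) :
  polytime P L -> polytime P init ->
  polytime (fun z => P (dtl (dtl z))) (fun z => step (dtl (dtl z)) (dhd (dtl z)) (dhd z)) ->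
  poly_bounded (fun z => P (dtl z)) d ->
  (forall x a acc, P x -> dsize (step x acc a) <= dsize acc + d (dcons a x)) ->
  polytime P (fun x => foldl (step x) (init x) (items (L x))).
Proof.
move=> LP iP sP dP grow; apply: (polytime_foldl (I := fun _ _ => True) (d := d)) => //.
  by apply: polytime_sub sP => z [].
by move=> x a acc Px _; apply: grow.
Qed.

Lemma polytime_under P (g : data -> data -> data) :
  polytime (fun z => P (dtl z)) (fun z => g (dtl z) (dhd z)) ->
  polytime (fun z => P (dtl (dtl z))) (fun z => g (dtl (dtl z)) (dhd z)).
Proof.
move=> gP; apply: (polytime_comp (Q := fun z => P (dtl z)) (f := fun z => dcons (dhd z) (dtl (dtl z)))) gP => //.
apply: polytime_dcons; first exact/polytime_dhd/polytime_id.
exact/polytime_dtl/polytime_dtl/polytime_id.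
Qed.

(** The one fold behind map, filter and reversal. Pushing in front reverses the order, so the
    order-preserving versions reverse once more. *)
Definition rev_filter_map (b : data -> bool) (g : data -> data) (s : seq data) (r : data) : data :=
  foldl (fun acc a => if b a then dcons (g a) acc else acc) r s.

Lemma rev_filter_mapE b g s r :
  rev_filter_map b g s r = enc_seq (catrev [seq g a | a <- s & b a] (items r)).
Proof.
rewrite /rev_filter_map; elim: s r => [|a s IHs] r /=; first by rewrite enc_seq_items.
by rewrite IHs; case: (b a).
Qed.

Lemma polytime_rev_filter_map P L r (b : data -> data -> bool) (g : data -> data -> data) :
  polytime P L -> polytime P r ->
  polytime (fun z => P (dtl z)) (fun z => enc_bool (b (dtl z) (dhd z))) ->
  polytime (fun z => P (dtl z)) (fun z => g (dtl z) (dhd z)) ->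
  polytime P (fun x => rev_filter_map (b x) (g x) (items (L x)) (r x)).
Proof.
move=> LP rP bP gP.
apply: (polytime_foldl_total (step := fun x acc a => if b x a then dcons (g x a) acc else acc)
   (d := fun z => 1 + dsize (g (dtl z) (dhd z)))) => //.
- apply: polytime_if_total.
  + exact: (polytime_under (g := fun x a => enc_bool (b x a))).
  + apply: polytime_dcons; first exact: polytime_under.
    exact/polytime_dhd/polytime_dtl/polytime_id.
  + exact/polytime_dhd/polytime_dtl/polytime_id.
- by apply: poly_bounded_add (poly_bounded_cst _ _) (polytime_dsize gP).
- by move=> x a acc _; case: ifP => _ /=; lia.
Qed.

Lemma polytime_rev P L : polytime P L -> polytime P (fun x => enc_seq (rev (items (L x)))).
Proof.
move=> LP.
apply: (@eq_polytime P (fun x => rev_filter_map xpredT id (items (L x)) dnil)).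
  by move=> x _; rewrite rev_filter_mapE filter_predT map_id.
apply: polytime_rev_filter_map (LP) (polytime_cst _ _) _ _; last exact/polytime_dhd/polytime_id.
exact: polytime_cst.
Qed.

Lemma polytime_filter_map P L (b : data -> data -> bool) (g : data -> data -> data) :
  polytime P L ->
  polytime (fun z => P (dtl z)) (fun z => enc_bool (b (dtl z) (dhd z))) ->
  polytime (fun z => P (dtl z)) (fun z => g (dtl z) (dhd z)) ->
  polytime P (fun x => enc_seq [seq g x a | a <- items (L x) & b x a]).
Proof.
move=> LP bP gP.
apply: (@eq_polytime P (fun x => enc_seq (rev (items (rev_filter_map (b x) (g x) (items (L x)) dnil))))).
  by move=> x _; rewrite rev_filter_mapE items_enc_seq revK.
by apply/polytime_rev/polytime_rev_filter_map => //; apply: polytime_cst.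
Qed.

Lemma polytime_map P L (g : data -> data -> data) :
  polytime P L -> polytime (fun z => P (dtl z)) (fun z => g (dtl z) (dhd z)) ->
  polytime P (fun x => enc_seq [seq g x a | a <- items (L x)]).
Proof.
move=> LP gP; apply: (@eq_polytime P (fun x => enc_seq [seq g x a | a <- items (L x) & xpredT a])).
  by move=> x _; rewrite filter_predT.
by apply: (polytime_filter_map (b := fun _ _ => true)) => //; apply: polytime_cst.
Qed.

Lemma polytime_filter P L (b : data -> data -> bool) :
  polytime P L -> polytime (fun z => P (dtl z)) (fun z => enc_bool (b (dtl z) (dhd z))) ->
  polytime P (fun x => enc_seq [seq a <- items (L x) | b x a]).
Proof.
move=> LP bP; apply: (@eq_polytime P (fun x => enc_seq [seq id a | a <- items (L x) & b x a])).
  by move=> x _; rewrite map_id.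
by apply: (polytime_filter_map (g := fun _ => id)) => //; apply/polytime_dhd/polytime_id.
Qed.

Lemma polytime_has P L (b : data -> data -> bool) :
  polytime P L -> polytime (fun z => P (dtl z)) (fun z => enc_bool (b (dtl z) (dhd z))) ->
  polytime P (fun x => enc_bool (has (b x) (items (L x)))).
Proof.
move=> LP bP.
apply: (@eq_polytime P (fun x => enc_bool (truth (enc_seq [seq a <- items (L x) | b x a])))).
  by move=> x _; elim: (items (L x)) => //= a s; case: (b x a).
exact/polytime_truth/polytime_filter.
Qed.

(* Entries missing at the end of the second list are read as the atom. *)
Fixpoint zip_data (s : seq data) (y : data) : seq data :=
  if s is a :: s' then dcons a (dhd y) :: zip_data s' (dtl y) else [::].

Lemma zip_data_map (A : Type) (s : seq A) (F G : A -> data) :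
  zip_data (map F s) (enc_seq (map G s)) = [seq dcons (F v) (G v) | v <- s].
Proof. by elim: s => //= v s ->. Qed.

Lemma size_zip_data s y : size (zip_data s y) = size s.
Proof. by elim: s y => //= a s IHs y; rewrite IHs. Qed.

Definition zipd (x y : data) : data := enc_seq (zip_data (items x) y).

Lemma items_zipd (A : Type) (s : seq A) (F G : A -> data) :
  items (zipd (enc_seq (map F s)) (enc_seq (map G s))) = [seq dcons (F v) (G v) | v <- s].
Proof. by rewrite !items_enc_seq zip_data_map. Qed.

Lemma zipd_map (A : Type) (s : seq A) (F G : A -> data) :
  zipd (enc_seq (map F s)) (enc_seq (map G s)) = enc_seq [seq dcons (F v) (G v) | v <- s].
Proof. by rewrite -items_zipd enc_seq_items. Qed.

Lemma polytime_zip P f g : polytime P f -> polytime P g ->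
  polytime P (fun x => zipd (f x) (g x)).
Proof.
rewrite /zipd.
move=> fP gP.
(* The accumulator pairs the unread rest of the second list with the reversed output. *)
pose step (_ acc a : data) := dcons (dtl (dhd acc)) (dcons (dcons a (dhd (dhd acc))) (dtl acc)).
have stepE (s : seq data) y r x :
    dtl (foldl (step x) (dcons y (enc_seq r)) s) = enc_seq (catrev (zip_data s y) r).
  by elim: s y r => //= a s IHs y r; apply: (IHs (dtl y) (dcons a (dhd y) :: r)).
apply: (@eq_polytime P (fun x => enc_seq (rev (items (dtl (foldl (step x) (dcons (g x) dnil) (items (f x)))))))).
  by move=> x _; rewrite -[dnil]/(enc_seq [::]) stepE items_enc_seq -/(rev _) revK.
apply/polytime_rev/polytime_dtl.
apply: (polytime_foldl_total (d := fun z => dsize z + 10)) => //.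
- by apply: polytime_dcons => //; apply: polytime_cst.
- have zP : polytime (fun z => P (dtl (dtl z))) id by apply: polytime_id.
  apply: polytime_dcons; first exact/polytime_dtl/polytime_dhd/polytime_dhd/polytime_dtl.
  apply: polytime_dcons; last exact/polytime_dtl/polytime_dhd/polytime_dtl.
  apply: polytime_dcons; first exact/polytime_dhd.
  exact/polytime_dhd/polytime_dhd/polytime_dhd/polytime_dtl.
- exact: poly_bounded_add (poly_bounded_dsize _) (poly_bounded_cst _ _).
- by move=> x a [|[|? ?] ?] _ /=; lia.
Qed.

Lemma polytime_fun1 P (F : data -> data) f :
  polytime (fun=> True) F -> polytime P f -> polytime P (fun x => F (f x)).
Proof. by move=> FP fP; apply: polytime_comp fP FP. Qed.

Lemma polytime_fun2 P (F : data -> data -> data) f g :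
  polytime (fun=> True) (fun z => F (dhd z) (dtl z)) ->
  polytime P f -> polytime P g -> polytime P (fun x => F (f x) (g x)).
Proof.
by move=> FP fP gP; apply: (polytime_comp (f := fun x => dcons (f x) (g x))) FP => //; apply: polytime_dcons.
Qed.

Lemma polytime_fun3 P (F : data -> data -> data -> data) f g h :
  polytime (fun=> True) (fun z => F (dhd z) (dhd (dtl z)) (dtl (dtl z))) ->
  polytime P f -> polytime P g -> polytime P h -> polytime P (fun x => F (f x) (g x) (h x)).
Proof.
move=> FP fP gP hP; apply: (polytime_comp (f := fun x => dcons (f x) (dcons (g x) (h x)))) FP => //.
by do 2?[apply: polytime_dcons => //].
Qed.

End ListPrograms.

Ltac polytime_step :=
  cbv beta; lazymatch goal with
  | |- polytime _ (fun x => x) => apply: polytime_id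
  | |- polytime _ dhd => apply/polytime_dhd/polytime_id
  | |- polytime _ dtl => apply/polytime_dtl/polytime_id
  | |- polytime _ (fun x => dhd _) => apply: polytime_dhd
  | |- polytime _ (fun x => dtl _) => apply: polytime_dtl
  | |- polytime _ (fun x => dcons _ _) => apply: polytime_dcons
  | |- polytime _ (fun x => enc_bool (truth _)) => apply: polytime_truth
  | |- polytime _ (fun x => enc_bool (_ && _)) => apply: polytime_andb
  | |- polytime _ (fun x => enc_bool (_ || _)) => apply: polytime_orb
  | |- polytime _ (fun x => enc_bool (~~ _)) => apply: polytime_negb
  | |- polytime _ (fun x => enc_bool (has _ _)) => apply: polytime_has
  | |- polytime _ (fun x => if _ then _ else _) => apply: polytime_if_total
  | |- polytime _ (fun x => zipd _ _) => apply: polytime_zip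
  | |- polytime _ (fun x => enc_seq [seq _ | _ <- _ & _]) => apply: polytime_filter_map
  | |- polytime _ (fun x => enc_seq [seq _ <- _ | _]) => apply: polytime_filter
  | |- polytime _ (fun x => enc_seq [seq _ | _ <- _]) => apply: polytime_map
  | |- polytime _ (fun x => rev_filter_map _ _ _ _) => apply: polytime_rev_filter_map
  | |- polytime _ (fun=> _) => apply: polytime_cst
  end.
Ltac polytime := repeat polytime_step.

(** * The search program *)

Section SearchProgram.
Implicit Types (P : data -> Prop).

Lemma dsize_enc_bools (A : Type) (b : A -> bool) (s : seq A) :
  dsize (enc_seq [seq enc_bool (b a) | a <- s]) <= 1 + 4 * size s.
Proof. by elim: s => //= a s IHs; case: (b a) => /=; lia. Qed.

(** A list of n atoms is already n in unary. Each turn strips one [dcons] from this counter and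
    pushes the result, from n - 1 down to 0, so the names end up in increasing order. *)
Definition vertex_list (adj : data) : data :=
  dtl (foldl (fun acc _ => dcons (dtl (dhd acc)) (dcons (dtl (dhd acc)) (dtl acc)))
    (dcons (enc_seq [seq dnil | _ <- items adj]) dnil) (items adj)).

(** Each turn copies the counter, so the growth is uniform only under an invariant that bounds the
    counter by the input. *)
Lemma polytime_vertex_list : polytime (fun=> True) vertex_list.
Proof.
apply/polytime_dtl.
apply: (polytime_foldl (L := id) (I := fun x acc => dsize (dhd acc) <= 2 * dsize x)
  (step := fun _ acc _ => dcons (dtl (dhd acc)) (dcons (dtl (dhd acc)) (dtl acc)))
  (d := fun z => 4 * dsize z + 2)).
- exact: polytime_id.
- by polytime; apply: polytime_id.
- by move=> x _ /=; elim: x => //= *; lia.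
- by move=> x _ acc _; apply: leq_trans; apply: dsize_dtl.
- by polytime; apply: polytime_id.
- apply: poly_bounded_add (poly_bounded_cst _ _).
  exact: poly_bounded_mul (poly_bounded_cst _ _) (poly_bounded_dsize _).
- by move=> x a [|u r] _ /=; [lia|have := dsize_dtl u; lia].
Qed.

(** As many false entries as [v] counts in unary, then a true one; zipping against [row] pads with
    atoms to full length. *)
Definition singleton_mask (row v : data) : data :=
  enc_seq [seq dtl z | z <- items (zipd row
    (rev_filter_map xpredT (fun=> dnil) (items v) (dcons (dcons dnil dnil) dnil)))].

Lemma polytime_singleton_mask :
  polytime (fun=> True) (fun z => singleton_mask (dhd z) (dtl z)).
Proof. by rewrite /singleton_mask; polytime. Qed.

(** Each vertex travels with its name, its singleton mask and its adjacency row, so the program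
    never indexes into a list: set operations are zips. *)
Definition tagged_rows (adj : data) : data :=
  enc_seq [seq dcons (dhd z) (dcons (singleton_mask (dtl z) (dhd z)) (dtl z))
          | z <- items (zipd (vertex_list adj) adj)].

Lemma polytime_tagged_rows : polytime (fun=> True) tagged_rows.
Proof.
rewrite /tagged_rows; polytime; first by apply: (polytime_fun1 polytime_vertex_list); polytime.
by apply: (polytime_fun2 polytime_singleton_mask); polytime.
Qed.

Definition meets (row m : data) : bool :=
  has (fun y => truth (dhd y) && truth (dtl y)) (items (zipd row m)).

Lemma polytime_meets P f g : polytime P f -> polytime P g ->
  polytime P (fun x => enc_bool (meets (f x) (g x))).
Proof.
move=> fP gP; apply: (polytime_fun2 (F := fun u v => enc_bool (meets u v))) => //.
by rewrite /meets; polytime.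
Qed.

Definition reach_step (tags U M0 M : data) : data :=
  enc_seq [seq enc_bool (truth (dtl (dtl z)) ||
      truth (dhd (dtl z)) && meets (dtl (dtl (dhd z))) M)
    | z <- items (zipd tags (zipd U M0))].

(** Breadth-first search from [M0] inside [U]; one round per vertex reaches the fixed point. *)
Definition reach (tags U M0 : data) : data :=
  foldl (fun M _ => reach_step tags U M0 M) (enc_seq [seq dnil | _ <- items tags]) (items tags).

Lemma polytime_reach :
  polytime (fun=> True) (fun z => reach (dhd z) (dhd (dtl z)) (dtl (dtl z))).
Proof.
apply: (polytime_foldl_total (L := dhd)
  (step := fun z M _ => reach_step (dhd z) (dhd (dtl z)) (dtl (dtl z)) M)
  (d := fun z => 1 + 4 * dsize z)).
- by polytime.
- by polytime.
- rewrite /reach_step; polytime; apply: polytime_meets; by polytime.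
- apply: poly_bounded_add (poly_bounded_cst _ _) _.
  exact: poly_bounded_mul (poly_bounded_cst _ _) (poly_bounded_dsize _).
- move=> x a M _; apply: leq_trans (leq_addl _ _); apply: leq_trans (dsize_enc_bools _ _) _.
  rewrite leq_add2l leq_mul2l /= /zipd items_enc_seq size_zip_data.
  apply: leq_trans (ltnW (size_items _)) _; apply: leq_trans (dsize_dhd x) _.
  by rewrite ltnW // ltnS leq_addl.
Qed.

Definition restrict_matrix (adj H M0 : data) : data :=
  enc_seq [seq enc_seq [seq enc_bool
      ([|| [&& truth (dhd (dtl z)), truth (dhd (dtl y)) & truth (dhd y)],
           truth (dtl (dtl z)) && ~~ truth (dhd (dtl y))
         | truth (dtl (dtl y)) && ~~ truth (dhd (dtl z))])
    | y <- items (zipd (dhd z) (zipd H M0))] | z <- items (zipd adj (zipd H M0))].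

Lemma polytime_restrict_matrix :
  polytime (fun=> True) (fun z => restrict_matrix (dhd z) (dhd (dtl z)) (dtl (dtl z))).
Proof. by rewrite /restrict_matrix; polytime. Qed.

(** The atom encodes the number 0, whose binary expansion is empty. *)
Definition restrict_list (C H : data) : data :=
  enc_seq [seq if truth (dtl z) then dhd z else dnil | z <- items (zipd C H)].

Lemma polytime_restrict_list :
  polytime (fun=> True) (fun z => restrict_list (dhd z) (dtl z)).
Proof. by rewrite /restrict_list; polytime. Qed.

Definition restrict_data (x H M0 : data) : data :=
  dcons (restrict_matrix (dhd x) H M0)
    (dcons (restrict_list (dhd (dtl x)) H) (restrict_list (dtl (dtl x)) H)).

Lemma polytime_restrict_data :
  polytime (fun=> True) (fun z => restrict_data (dhd z) (dhd (dtl z)) (dtl (dtl z))).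
Proof.
rewrite /restrict_data; polytime.
- by apply: (polytime_fun3 polytime_restrict_matrix); polytime.
- by apply: (polytime_fun2 polytime_restrict_list); polytime.
- by apply: (polytime_fun2 polytime_restrict_list); polytime.
Qed.

Definition first_mask (tags U : data) : data :=
  dhd (dtl (dhd (enc_seq [seq dhd z | z <- items (zipd tags U) & truth (dtl z)]))).

Lemma polytime_first_mask :
  polytime (fun=> True) (fun z => first_mask (dhd z) (dtl z)).
Proof. by rewrite /first_mask; polytime. Qed.

Definition mask_and (H S : data) : data :=
  enc_seq [seq enc_bool (truth (dhd z) && truth (dtl z)) | z <- items (zipd H S)].

Definition separator_data (H M0 out : data) : data :=
  if has truth (items (mask_and H (dhd (dtl out))))
  then mask_and H (dhd (dtl out)) else M0.

Lemma polytime_separator_data :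
  polytime (fun=> True) (fun z => separator_data (dhd z) (dhd (dtl z)) (dtl (dtl z))).
Proof. by rewrite /separator_data /mask_and; polytime. Qed.

(** Zipping along [tags] caps the length of the result whatever [U] is; the loop rule asks for
    growth independent of the accumulator. *)
Definition mask_diff (tags U S : data) : data :=
  enc_seq [seq enc_bool (truth (dhd (dtl z)) && ~~ truth (dtl (dtl z)))
          | z <- items (zipd tags (zipd U S))].

Lemma polytime_mask_diff :
  polytime (fun=> True) (fun z => mask_diff (dhd z) (dhd (dtl z)) (dtl (dtl z))).
Proof. by rewrite /mask_diff; polytime. Qed.

Definition push_mask (tags S o : data) : data :=
  rev_filter_map (fun z => truth (dtl z)) dhd (items (zipd tags S)) o.

Lemma polytime_push_mask :
  polytime (fun=> True) (fun z => push_mask (dhd z) (dhd (dtl z)) (dtl (dtl z))).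
Proof. by rewrite /push_mask; polytime. Qed.

Lemma dsize_push_mask tags S o : dsize (push_mask tags S o) <= dsize tags + dsize o.
Proof.
rewrite /push_mask /zipd items_enc_seq /rev_filter_map.
elim: tags S o => [|a _ s IHs] S o /=; first by rewrite leqnSn.
apply: leq_trans (IHs _ _) _; case: ifP => _ /=; lia.
Qed.

Variable oracle : data -> data.

Definition component_data (tags U : data) : data := reach tags U (first_mask tags U).

Definition next_separator (tags x U : data) : data :=
  separator_data (component_data tags U) (first_mask tags U)
    (oracle (restrict_data x (component_data tags U) (first_mask tags U))).

Definition elimination_step (env acc : data) : data :=
  if has truth (items (dhd acc)) then
    dcons (mask_diff (dhd env) (dhd acc) (next_separator (dhd env) (dtl env) (dhd acc)))
      (push_mask (dhd env) (next_separator (dhd env) (dtl env) (dhd acc)) (dtl acc))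
  else acc.

Lemma polytime_component_data :
  polytime (fun=> True) (fun z => component_data (dhd z) (dtl z)).
Proof.
rewrite /component_data; apply: (polytime_fun3 polytime_reach); polytime.
by apply: (polytime_fun2 polytime_first_mask); polytime.
Qed.

(** The oracle is called only in the branch where a vertex is left, so its domain has to be
    respected only there. *)
Lemma polytime_elimination_step (Q J : data -> Prop) :
  polytime Q oracle ->
  (forall z, J z -> has truth (items (dhd (dtl z))) ->
     Q (restrict_data (dtl (dhd z)) (component_data (dhd (dhd z)) (dhd (dtl z)))
          (first_mask (dhd (dhd z)) (dhd (dtl z))))) ->
  polytime J (fun z => elimination_step (dhd z) (dtl z)).
Proof.
move=> FQ JQ; rewrite /elimination_step.
pose J' z := J z /\ has truth (items (dhd (dtl z))).
have sepP : polytime J' (fun z => next_separator (dhd (dhd z)) (dtl (dhd z)) (dhd (dtl z))).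
  have fP : polytime J' (fun z => first_mask (dhd (dhd z)) (dhd (dtl z))).
    by apply: (polytime_fun2 polytime_first_mask); polytime.
  have cP : polytime J' (fun z => component_data (dhd (dhd z)) (dhd (dtl z))).
    by apply: (polytime_fun2 polytime_component_data); polytime.
  apply: (polytime_fun3 polytime_separator_data) => //.
  apply: polytime_comp FQ; first by move=> z [Jz zU]; apply: JQ.
  by apply: (polytime_fun3 polytime_restrict_data) => //; polytime.
apply: polytime_ifb; [by polytime | | by polytime].
apply: polytime_dcons.
  by apply: (polytime_fun3 polytime_mask_diff) => //; polytime.
by apply: (polytime_fun3 polytime_push_mask) => //; polytime.
Qed.

Lemma dsize_elimination_step env acc :
  dsize (elimination_step env acc) <= dsize acc + (5 * dsize env + 10).
Proof.
rewrite /elimination_step; case: ifP => _; last exact: leq_addr.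
rewrite [leqLHS]/=.
set S := next_separator _ _ _.
have : dsize (mask_diff (dhd env) (dhd acc) S) <= 1 + 4 * dsize env.
  apply: leq_trans (dsize_enc_bools _ _) _; rewrite leq_add2l leq_mul2l /=.
  rewrite /zipd items_enc_seq size_zip_data.
  exact: leq_trans (ltnW (size_items _)) (dsize_dhd env).
have := dsize_push_mask (dhd env) S (dtl acc).
have := dsize_dhd env; have := dsize_dtl acc.
move: (dsize (mask_diff _ _ _)) (dsize (push_mask _ _ _)) (dsize (dhd env)) (dsize (dtl acc)).
by clear; lia.
Qed.

(** One turn per vertex suffices: with a correct oracle each turn removes a vertex while any is
    left, and later turns are idle. *)
Definition elimination_data (env : data) : data :=
  foldl (fun acc _ => elimination_step env acc)
    (dcons (enc_seq [seq dcons dnil dnil | _ <- items (dhd env)]) dnil) (items (dhd env)).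

Lemma polytime_elimination_data (Q P : data -> Prop) (I : data -> data -> Prop) :
  polytime Q oracle ->
  (forall env, P env -> I env (dcons (enc_seq [seq dcons dnil dnil | _ <- items (dhd env)]) dnil)) ->
  (forall env acc, P env -> I env acc -> I env (elimination_step env acc)) ->
  (forall env acc, P env -> I env acc -> has truth (items (dhd acc)) ->
     Q (restrict_data (dtl env) (component_data (dhd env) (dhd acc))
          (first_mask (dhd env) (dhd acc)))) ->
  polytime P elimination_data.
Proof.
move=> FQ Ii Is IQ.
apply: (polytime_foldl (L := dhd) (I := I) (step := fun env acc _ => elimination_step env acc)
   (d := fun z => 5 * dsize (dtl z) + 10)) => //.
- by polytime.
- by polytime.
- by move=> env _ acc Penv Iacc; apply: Is.
- apply: (polytime_comp (Q := fun z => P (dhd z) /\ I (dhd z) (dtl z))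
    (f := fun z => dcons (dtl (dtl z)) (dhd (dtl z)))
    (g := fun z => elimination_step (dhd z) (dtl z))) => //; first by polytime.
  by apply: polytime_elimination_step FQ _ => z [Pz Iz]; apply: IQ.
- apply: poly_bounded_add (poly_bounded_cst _ _).
  apply: poly_bounded_mul (poly_bounded_cst _ _) _.
  by apply: (poly_bounded_leq _ (poly_bounded_dsize _)) => z _; apply: dsize_dtl.
- by move=> env a acc _ _; apply: dsize_elimination_step.
Qed.

Definition mask_or (row m m' : data) : data :=
  enc_seq [seq enc_bool (truth (dhd (dtl z)) || truth (dtl (dtl z)))
          | z <- items (zipd row (zipd m m'))].

Definition mask_union (row m ts : data) : data :=
  foldl (fun m t => mask_or row m (dhd t)) m (items ts).

Lemma dsize_mask_or row m m' : dsize (mask_or row m m') <= 1 + 4 * dsize row.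
Proof.
apply: leq_trans (dsize_enc_bools _ _) _; rewrite leq_add2l leq_mul2l /=.
by rewrite /zipd items_enc_seq size_zip_data ltnW // size_items.
Qed.

Lemma polytime_mask_union :
  polytime (fun=> True) (fun z => mask_union (dhd z) (dhd (dtl z)) (dtl (dtl z))).
Proof.
apply: (polytime_foldl_total (L := fun z => dtl (dtl z))
  (step := fun z m t => mask_or (dhd z) m (dhd t)) (d := fun z => 1 + 4 * dsize z)).
- by polytime.
- by polytime.
- by rewrite /mask_or; polytime.
- apply: poly_bounded_add (poly_bounded_cst _ _) _.
  exact: poly_bounded_mul (poly_bounded_cst _ _) (poly_bounded_dsize _).
- move=> x a M _; apply: leq_trans (leq_addl _ _); apply: leq_trans (dsize_mask_or _ _ _) _.
  rewrite leq_add2l leq_mul2l; apply: leq_trans (dsize_dhd x) _.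
  by rewrite ltnW // ltnS leq_addl.
Qed.

Definition forest_children (row F : data) : data :=
  enc_seq [seq t <- items F | meets row (dhd t)].

Definition forest_step (F v : data) : data :=
  dcons (dcons (mask_union (dtl (dtl v)) (dhd (dtl v)) (forest_children (dtl (dtl v)) F))
      (dcons (dhd v) (enc_seq [seq dtl t | t <- items (forest_children (dtl (dtl v)) F)])))
    (enc_seq [seq t <- items F | ~~ meets (dtl (dtl v)) (dhd t)]).

Lemma polytime_forest_step :
  polytime (fun=> True) (fun z => forest_step (dhd z) (dtl z)).
Proof.
have chP : polytime (fun=> True) (fun z => forest_children (dtl (dtl (dtl z))) (dhd z)).
  by rewrite /forest_children; polytime; apply: polytime_meets; polytime.
rewrite /forest_step; polytime => //.
  by apply: (polytime_fun3 polytime_mask_union) => //; polytime.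
by apply: polytime_meets; polytime.
Qed.

(** The trees adjacent to the new root move into the new tree without being duplicated, so the
    growth depends on [v] alone. *)
Lemma dsize_forest_step F v : dsize (forest_step F v) <= dsize F + (9 * dsize v + 10).
Proof.
rewrite /forest_step; set row := dtl (dtl v).
have mu : dsize (mask_union row (dhd (dtl v)) (forest_children row F)) <= 5 * dsize v + 1.
  have rv : dsize row <= dsize v := leq_trans (dsize_dtl _) (dsize_dtl _).
  rewrite /mask_union; case/lastP: (items _) => [|ts t] /=.
    by have := leq_trans (dsize_dhd (dtl v)) (dsize_dtl v); lia.
  by rewrite foldl_rcons; have := dsize_mask_or row (foldl (fun m t => mask_or row m (dhd t)) (dhd (dtl v)) ts) (dhd t); lia.
have split_ : dsize (enc_seq [seq dtl t | t <- items (forest_children row F)])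
    + dsize (enc_seq [seq t <- items F | ~~ meets row (dhd t)]) <= dsize F + 1.
  rewrite /forest_children items_enc_seq -{3}(enc_seq_items F).
  elim: (items F) => //= t ts IHts; case: (meets row (dhd t)) => /=; last by lia.
  by have := dsize_dtl t; lia.
have := dsize_dhd v; rewrite /=.
move: split_ mu; move: (dsize (mask_union _ _ _)) (dsize (enc_seq [seq dtl t | t <- _])) (dsize (enc_seq [seq t <- _ | _])).
move: (dsize (dhd v)) (dsize v) (dsize F); clear; lia.
Qed.

Definition search_tree_data (x : data) : data :=
  dtl (dhd (foldl forest_step dnil (items (dtl (elimination_data (dcons (tagged_rows (dhd x)) x)))))).

Lemma polytime_search_tree_data (P : data -> Prop) :
  polytime (fun env => exists2 x, P x & env = dcons (tagged_rows (dhd x)) x) elimination_data ->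
  polytime P search_tree_data.
Proof.
move=> eP; rewrite /search_tree_data; apply/polytime_dtl/polytime_dhd.
apply: (polytime_foldl_total (L := fun x => dtl (elimination_data (dcons (tagged_rows (dhd x)) x)))
  (step := fun _ F v => forest_step F v) (d := fun z => 9 * dsize (dhd z) + 10)).
- apply/polytime_dtl; apply: polytime_comp eP; first by move=> x Px; exists x.
  by polytime; apply: (polytime_fun1 polytime_tagged_rows); polytime.
- by polytime.
- by apply: (polytime_fun2 polytime_forest_step); polytime.
- apply: poly_bounded_add (poly_bounded_cst _ _).
  apply: poly_bounded_mul (poly_bounded_cst _ _) _.
  by apply: (poly_bounded_leq _ (poly_bounded_dsize _)) => z _; apply: dsize_dhd.
- by move=> x v F' _; apply: dsize_forest_step.
Qed.

End SearchProgram.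

(** * Correctness of the search program *)

Section Encodings.

Lemma vertex_list_enc n (s : seq data) : size s = n ->
  vertex_list (enc_seq s) = enc_seq [seq enc_vertex v | v <- enum 'I_n].
Proof.
pose unary m := iter m (dcons dnil) dnil.
have foldE r t k : dtl (foldl (fun acc _ => dcons (dtl (dhd acc)) (dcons (dtl (dhd acc)) (dtl acc)))
    (dcons (unary (k + size t)) (enc_seq r)) t) = enc_seq (map unary (iota k (size t)) ++ r).
  elim: t r => // a t IHt r; rewrite -[size (a :: t)]addn1 iotaD map_cat -catA -IHt.
  by rewrite addnA addn1.
move=> sn; rewrite /vertex_list items_enc_seq (_ : enc_seq [seq dnil | _ <- s] = unary (0 + size s)).
  rewrite -[dnil]/(enc_seq [::]) foldE cats0 sn -val_enum_ord -map_comp.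
  by congr enc_seq; apply: eq_map.
by elim: s {sn} => //= a s ->.
Qed.

Lemma dtl_zip_data s y : [seq dtl z | z <- zip_data s y] = mkseq (nth dnil (items y)) (size s).
Proof.
elim: s y => // a s IHs y; rewrite /= IHs /mkseq /= -[1]addn0 iotaDl -map_comp.
case: y => [|u y] /=; congr (_ :: _); apply: eq_map => k /=; first by rewrite !nth_nil.
Qed.

Lemma singleton_mask_enc n (row : seq data) (v : 'I_n) : size row = n ->
  singleton_mask (enc_seq row) (enc_vertex v) = enc_set [set v].
Proof.
move=> rn; rewrite /singleton_mask /zipd !items_enc_seq dtl_zip_data rn rev_filter_mapE.
rewrite filter_predT items_enc_seq /enc_set /mkseq -val_enum_ord -map_comp.
congr enc_seq; apply: eq_map => u /=; rewrite inE -val_eqE /=.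
have -> : [seq dnil | _ <- items (enc_vertex v)] = nseq v dnil.
  by rewrite /enc_vertex; elim: (nat_of_ord v) => //= k ->.
rewrite catrevE rev_nseq nth_cat size_nseq.
case: ltngtP => uv; first by rewrite nth_nseq uv.
  by rewrite -(subnSK uv) /= nth_nil.
by rewrite uv subnn.
Qed.

Section Instance.
Variable i : instance.
Notation n := (nvert i).
Notation e := (@edge i).

Definition enc_row (v : 'I_n) : data := enc_seq [seq enc_bool (edge v u) | u <- enum 'I_n].

Definition enc_tag (v : 'I_n) : data :=
  dcons (enc_vertex v) (dcons (enc_set [set v]) (enc_row v)).

Definition enc_tags : data := enc_seq [seq enc_tag v | v <- enum 'I_n].

Lemma tagged_rows_enc : tagged_rows (dhd (enc_instance i)) = enc_tags.
Proof.
rewrite /tagged_rows -[dhd _]/(enc_seq [seq enc_row v | v <- enum 'I_n]).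
have sz : size [seq enc_row v | v <- enum 'I_n] = n by rewrite size_map size_enum_ord.
rewrite (vertex_list_enc sz) items_zipd -map_comp; congr enc_seq; apply: eq_map => v.
by congr (dcons _ (dcons _ _)); apply: singleton_mask_enc; rewrite size_map size_enum_ord.
Qed.

Lemma has_enum (p : pred 'I_n) : has p (enum 'I_n) = [exists v, p v].
Proof.
apply/hasP/existsP => [[v _ pv]|[v pv]]; first by exists v.
by exists v; rewrite ?mem_enum.
Qed.

Lemma meets_enc (v : 'I_n) (A : {set 'I_n}) : meets (enc_row v) (enc_set A) = adjacent e v A.
Proof.
rewrite /meets items_zipd has_map has_enum /adjacent; apply: eq_existsb => u /=.
by rewrite !truth_enc_bool andbC.
Qed.

Lemma zipd_tags (G : 'I_n -> data) :
  zipd enc_tags (enc_seq [seq G v | v <- enum 'I_n])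
  = enc_seq [seq dcons (enc_tag v) (G v) | v <- enum 'I_n].
Proof. exact: zipd_map. Qed.

Lemma enc_set0 : enc_seq [seq dnil | _ <- items enc_tags] = @enc_set n set0.
Proof.
rewrite items_enc_seq -map_comp; congr enc_seq; apply: eq_map => v /=.
by rewrite inE.
Qed.

Definition reach_set (U : {set 'I_n}) (h : 'I_n) (M : {set 'I_n}) : {set 'I_n} :=
  h |: [set v in U | adjacent e v M].

Lemma reach_step_enc (U M : {set 'I_n}) (h : 'I_n) :
  reach_step enc_tags (enc_set U) (enc_set [set h]) (enc_set M) = enc_set (reach_set U h M).
Proof.
rewrite /reach_step zipd_map zipd_tags items_enc_seq -map_comp.
congr enc_seq; apply: eq_map => v /=.
by rewrite !truth_enc_bool meets_enc !inE.
Qed.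

(** A monotone map on subsets of an n-element set reaches its least fixed point within n iterations
    from the empty set. *)
Lemma reach_set_fix (U : {set 'I_n}) (h : 'I_n) : h \in U ->
  iter n (reach_set U h) set0 = component e U h.
Proof.
move=> hU; have mono : {homo reach_set U h : X Y / X \subset Y}.
  move=> X Y XY; apply: setUS; apply/subsetP => v; rewrite !inE => /andP[-> /exists_inP[u uX vu]].
  by apply/exists_inP; exists u => //; apply: (subsetP XY).
rewrite -[X in iter X](card_ord n) -/(fixset (reach_set U h)).
have fixE := fixsetK mono; apply/eqP; rewrite eqEsubset; apply/andP; split.
  rewrite /fixset; elim: #|_| => [|k IHk]; first exact: sub0set.
  apply/subsetP => v; rewrite /= !inE => /orP[/eqP->|/andP[vU /exists_inP[u uM vu]]].
    by rewrite hU connect0.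
  have := component_closed (subsetP IHk u uM) vU; rewrite inE; apply.
  by rewrite edge_sym.
apply/subsetP => v; rewrite inE => /andP[_]; apply: connect_closed_in.
  move=> u y uF yU uy; rewrite -fixE !inE yU /=; apply/orP; right.
  by apply/exists_inP; exists u => //; rewrite edge_sym.
by rewrite -fixE !inE eqxx.
Qed.

Lemma reach_enc (U : {set 'I_n}) (h : 'I_n) : h \in U ->
  reach enc_tags (enc_set U) (enc_set [set h]) = enc_set (component e U h).
Proof.
move=> hU; rewrite -reach_set_fix // /reach enc_set0.
have sz : size (items enc_tags) = n by rewrite items_enc_seq size_map size_enum_ord.
rewrite -[X in iter X _ _]sz.
move: (items enc_tags) => s; elim/last_ind: s => //= s a IHs.
by rewrite foldl_rcons IHs reach_step_enc size_rcons.
Qed.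

Lemma restrict_list_enc (g : 'I_n -> nat) (H : {set 'I_n}) :
  restrict_list (enc_seq [seq enc_nat (g v) | v <- enum 'I_n]) (enc_set H)
  = enc_seq [seq enc_nat (restrict_fun H g v) | v <- enum 'I_n].
Proof.
rewrite /restrict_list items_zipd -map_comp; congr enc_seq; apply: eq_map => v /=.
by rewrite truth_enc_bool /restrict_fun; case: (v \in H).
Qed.

Lemma restrict_data_enc (H : {set 'I_n}) (h : 'I_n) (hH : h \in H) (Hc : connected e H) :
  restrict_data (enc_instance i) (enc_set H) (enc_set [set h])
  = enc_instance (restrict_instance hH Hc).
Proof.
rewrite /restrict_data /= !restrict_list_enc; congr (dcons _ _).
rewrite /restrict_matrix zipd_map items_zipd -map_comp; congr enc_seq; apply: eq_map => u /=.
rewrite items_zipd -map_comp; congr enc_seq; apply: eq_map => v /=.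
by rewrite !truth_enc_bool !inE.
Qed.

Lemma first_mask_enc (U : {set 'I_n}) : U != set0 ->
  exists2 h, h \in U & first_mask enc_tags (enc_set U) = enc_set [set h].
Proof.
move=> U0; rewrite /first_mask zipd_tags items_enc_seq.
rewrite filter_map -map_comp (eq_filter (a2 := mem U)) => [|v]; last by rewrite /= truth_enc_bool.
have [v vU] := set0Pn _ U0.
have memU u : (u \in [seq v <- enum 'I_n | mem U v]) = (u \in U).
  by rewrite mem_filter mem_enum andbT.
case: filter memU => [|h s] memU; first by move: (memU v); rewrite vU.
by exists h; rewrite // -memU mem_head.
Qed.

Lemma has_truth_enc_set (X : {set 'I_n}) : has truth (items (enc_set X)) = [exists v, v \in X].
Proof.
rewrite items_enc_seq has_map has_enum; apply: eq_existsb => v /=.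
exact: truth_enc_bool.
Qed.

Lemma separator_data_enc (H : {set 'I_n}) (h : 'I_n) (hH : h \in H) (Hc : connected e H)
    (K : cut (restrict_instance hH Hc)) :
  separator_data (enc_set H) (enc_set [set h]) (enc_cut K) = enc_set (separator_of K).
Proof.
rewrite /separator_data /=.
have -> : mask_and (enc_set H) (enc_set (sep K)) = enc_set (sep K :&: H).
  rewrite /mask_and items_zipd -map_comp; congr enc_seq; apply: eq_map => v /=.
  by rewrite !truth_enc_bool inE andbC.
by rewrite has_truth_enc_set /separator_of; case: ifP.
Qed.

Lemma mask_diff_enc (U S : {set 'I_n}) :
  mask_diff enc_tags (enc_set U) (enc_set S) = enc_set (U :\: S).
Proof.
rewrite /mask_diff zipd_map zipd_tags items_enc_seq -map_comp; congr enc_seq; apply: eq_map => v /=.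
by rewrite !truth_enc_bool inE andbC.
Qed.

Lemma push_mask_enc (S : {set 'I_n}) (o : seq 'I_n) :
  push_mask enc_tags (enc_set S) (enc_seq (map enc_tag o))
  = enc_seq (map enc_tag (rev [seq v <- enum 'I_n | v \in S] ++ o)).
Proof.
rewrite /push_mask zipd_tags rev_filter_mapE !items_enc_seq filter_map -map_comp.
rewrite [in LHS](eq_filter (a2 := mem S)) => [|v]; last by rewrite /= truth_enc_bool.
by rewrite catrevE map_cat map_rev.
Qed.

Definition enc_forest (Fo : seq ({set 'I_n} * tree 'I_n)) : data :=
  enc_seq [seq dcons (enc_set p.1) (enc_tree p.2) | p <- Fo].

Lemma mask_or_enc (v : 'I_n) (A B : {set 'I_n}) :
  mask_or (enc_row v) (enc_set A) (enc_set B) = enc_set (A :|: B).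
Proof.
rewrite /mask_or zipd_map zipd_map items_enc_seq -map_comp; congr enc_seq; apply: eq_map => u /=.
by rewrite !truth_enc_bool inE.
Qed.

Lemma mask_union_enc (v : 'I_n) (A : {set 'I_n}) Fo :
  mask_union (enc_row v) (enc_set A) (enc_forest Fo) = enc_set (A :|: \bigcup_(p <- Fo) p.1).
Proof.
rewrite /mask_union items_enc_seq; elim: Fo A => [|p Fo IHF] A /=; first by rewrite big_nil setU0.
by rewrite mask_or_enc IHF big_cons setUA.
Qed.

Lemma forest_step_enc Fo (v : 'I_n) :
  forest_step (enc_forest Fo) (enc_tag v) = enc_forest (forest_add e Fo v).
Proof.
(* [false] gives the trees that become children, [true] those that stay in the forest. *)
have filterE (b : bool) : enc_seq [seq t <- items (enc_forest Fo) | b (+) meets (enc_row v) (dhd t)]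
    = enc_forest [seq p <- Fo | b (+) adjacent e v p.1].
  rewrite items_enc_seq filter_map; congr enc_seq; congr map.
  by apply: eq_filter => p /=; rewrite meets_enc.
rewrite /forest_step /= /forest_children (filterE false) mask_union_enc (filterE true).
by rewrite {2}/enc_forest items_enc_seq /enc_forest /= -!map_comp.
Qed.

Lemma forest_fold_enc Fo (o : seq 'I_n) :
  foldl forest_step (enc_forest Fo) (map enc_tag o) = enc_forest (foldl (forest_add e) Fo o).
Proof. by elim: o Fo => //= v o IHo Fo; rewrite forest_step_enc IHo. Qed.

End Instance.
End Encodings.

(** Decision trees are not given as a finite type, so the optimum comes from well-foundedness of
    [nat], classically. *)
Lemma exists_least (P : nat -> Prop) : (exists m, P m) ->
  exists2 m, P m & forall m', P m' -> m <= m'.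
Proof.
case=> m; elim/ltn_ind: m => m IHm Pm.
have [[m' [Pm' m'm]]|least] := classic (exists m', P m' /\ m' < m); first exact: IHm Pm'.
by exists m => // m' Pm'; rewrite leqNgt; apply/negP => m'm; apply: least; exists m'.
Qed.

(** * The search algorithm with a cut oracle *)

Section Search.
Variables (R : realFieldType) (f : nat -> R) (oracle : data -> data).
Hypothesis oracle_cut : forall i, exists2 K : cut i, approx_cut f K & oracle (enc_instance i) = enc_cut K.

Lemma oracle_ratio_ge0 (i : instance) : (0 <= f (nvert i))%R.
Proof. by have [K /approx_ratio_ge0] := oracle_cut (unit_instance i). Qed.

Definition search_env (i : instance) : data := dcons (enc_tags i) (enc_instance i).

Definition search_state (i : instance) (U : {set 'I_(nvert i)}) (o : seq 'I_(nvert i)) : data :=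
  dcons (enc_set U) (enc_seq (map (@enc_tag i) o)).
Arguments search_state : clear implicits.

Lemma search_state_init (i : instance) :
  dcons (enc_seq [seq dcons dnil dnil | _ <- items (dhd (search_env i))]) dnil
    = search_state i setT [::].
Proof.
rewrite /search_state /= items_enc_seq -map_comp /enc_set; congr (dcons (enc_seq _) _).
by apply: eq_map => v /=; rewrite inE.
Qed.

Lemma component_data_enc (i : instance) (U : {set 'I_(nvert i)}) : U != set0 ->
  exists2 h, h \in U & first_mask (enc_tags i) (enc_set U) = enc_set [set h] /\
    component_data (enc_tags i) (enc_set U) = enc_set (component (@edge i) U h).
Proof.
move=> /first_mask_enc[h hU hE]; exists h => //; split=> //.
by rewrite /component_data hE reach_enc.
Qed.

Lemma restricted_query (i : instance) (U : {set 'I_(nvert i)}) : U != set0 ->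
  exists j, restrict_data (enc_instance i) (component_data (enc_tags i) (enc_set U))
    (first_mask (enc_tags i) (enc_set U)) = enc_instance j.
Proof.
move=> /component_data_enc[h hU [-> ->]].
exists (restrict_instance (mem_component (@edge i) hU)
  (@component_connected _ _ (@edge_sym i) U h)).
exact: restrict_data_enc.
Qed.

Definition good_state (i : instance) (U : {set 'I_(nvert i)}) (o : seq 'I_(nvert i)) : Prop :=
  elimination_state (@edge i) (@cost i) (@weight i) (8 * f (nvert i))%R U o.
Arguments good_state : clear implicits.

(** The decrease of [U] comes from the separator being nonempty; the truncated predecessor also
    covers the idle turns. *)
Lemma elimination_step_enc (i : instance) (U : {set 'I_(nvert i)}) o :
  good_state i U o ->
  exists U' o', [/\ elimination_step oracle (search_env i) (search_state i U o) = search_state i U' o',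
    good_state i U' o' & #|U'| <= #|U|.-1].
Proof.
move=> Uo; rewrite /elimination_step [dhd (search_state i _ _)]/= has_truth_enc_set.
case: ifPn => [/existsP[v vU]|U0]; last first.
  exists U, o; split=> //; suff -> : #|U| = 0 by [].
  by apply: eq_card0 => v; apply/negbTE; apply: contra U0 => vU; apply/existsP; exists v.
have Un0 : U != set0 by apply/set0Pn; exists v.
have [h hU [fE cE]] := component_data_enc Un0.
have hH := mem_component (@edge i) hU.
have Hc := @component_connected _ _ (@edge_sym i) U h.
have [K Kap KE] := oracle_cut (restrict_instance hH Hc).
have cheap := approx_cut_cheap (oracle_ratio_ge0 i) Kap.
set S := separator_of K in cheap.
have SE : next_separator oracle (enc_tags i) (enc_instance i) (enc_set U) = enc_set S.
  by rewrite /next_separator fE cE (restrict_data_enc hH Hc) KE separator_data_enc.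
exists (U :\: S), (rev [seq v <- enum 'I_(nvert i) | v \in S] ++ o); split.
- by rewrite /= SE mask_diff_enc push_mask_enc.
- apply: (elimination_state_cat (@edge_sym i) _ hU cheap _ _ Uo).
  + by rewrite mulr_ge0 // oracle_ratio_ge0.
  + by rewrite rev_uniq filter_uniq // enum_uniq.
  + by move=> u; rewrite mem_rev mem_filter mem_enum andbT.
- have [SH /set0Pn[s sS] _] := cheap.
  have sU : s \in U := subsetP (component_sub _ _ _) _ (subsetP SH _ sS).
  rewrite [#|U|](cardsD1 s) sU /= subset_leq_card //; apply/subsetP => u.
  by rewrite !inE => /andP[uS ->]; rewrite andbT; apply: contraNneq uS => ->.
Qed.

Lemma elimination_data_enc (i : instance) :
  exists2 o, elimination_data oracle (search_env i) = search_state i set0 o & good_state i set0 o.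
Proof.
rewrite /elimination_data search_state_init.
have : #|[set: 'I_(nvert i)]| <= size (items (dhd (search_env i))).
  by rewrite /= items_enc_seq size_map size_enum_ord cardsT card_ord.
have := elimination_state0 (@edge i) (@cost i) (@weight i) (8 * f (nvert i))%R.
rewrite -/(good_state i _ _).
move: setT [::] (items _) => U o s; elim: s U o => [|a s IHs] U o Uo.
  by rewrite leqn0 cards_eq0 => /eqP U0; exists o; rewrite -?U0.
move=> Us /=; have [U' [o' [-> U'o' U'U]]] := elimination_step_enc Uo.
by apply: IHs => //; apply: leq_trans U'U _; case: #|U| Us.
Qed.

Lemma search_tree_data_enc (i : instance) :
  exists2 D, search_tree_data oracle (enc_instance i) = enc_tree D &
    @approx_tree i R (fun n => 16 * f n)%R D.
Proof.
rewrite /search_tree_data tagged_rows_enc -/(search_env i).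
have [o -> o_good] := elimination_data_enc i.
rewrite [dtl (search_state i _ _)]/= items_enc_seq -[dnil]/(enc_forest (i := i) [::]) forest_fold_enc.
have x0 := Ordinal (nvert_gt0 i).
have a_ge0 : (0 <= 8 * f (nvert i))%R by rewrite mulr_ge0 // oracle_ratio_ge0.
have iC := @setT_connected i.
(* An optimum exists once some decision tree does; the computed order yields one. *)
have [D0 dtD0] : exists D0, decision_tree (@edge i) setT D0.
  have [uo oT [B Bo _]] := o_good.
  have [|D0 [_ dtD0 _]] := elimination_treeP (@edge_sym i) x0 iC uo _ Bo; last by exists D0.
  by move=> v; rewrite oT inE.
have [m [Dopt dtDopt Dm] m_min] := @exists_least (fun m => exists2 D,
  decision_tree (@edge i) setT D & tree_cost (@cost i) (@weight i) D = m)
  (ex_intro _ _ (ex_intro2 _ _ D0 dtD0 erefl)).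
have [D [De dtD Dcost]] := elimination_state_cost (@edge_sym i) a_ge0 x0 iC o_good dtDopt.
exists D; first by rewrite De.
split=> //; exists m; last first.
  (* 16 is 2, from the initial potential, times 8, from the balanced cut. *)
  by apply: le_trans Dcost _; rewrite Dm mulrA -natrM.
split; first by exists Dopt.
by move=> D' dtD'; apply: m_min; exists D'.
Qed.

Lemma polytime_search : polytime (fun x => exists i, x = enc_instance i) oracle ->
  polytime (fun x => exists i, x = enc_instance i) (search_tree_data oracle).
Proof.
move=> oP; apply: polytime_search_tree_data.
pose I env acc := exists i U o, [/\ env = search_env i, acc = search_state i U o & good_state i U o].
apply: (polytime_elimination_data (I := I) oP).
- move=> _ [_ [i ->] ->]; rewrite tagged_rows_enc -/(search_env i) search_state_init.
  by exists i, setT, [::]; split=> //; apply: elimination_state0.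
- move=> _ _ _ [i [U [o [-> -> Uo]]]].
  by have [U' [o' [-> U'o' _]]] := elimination_step_enc Uo; exists i, U', o'.
- move=> _ _ _ [i [U [o [-> -> Uo]]]] /=; rewrite has_truth_enc_set => /existsP[v vU].
  by apply: restricted_query; apply/set0Pn; exists v.
Qed.

End Search.

Local Open Scope ring_scope.

Theorem theorem4 (R : realFieldType) (f : nat -> R) :
  (exists p : prog, min_ratio_cut_algorithm f p) ->
  exists (C : R) (q : prog),
    0 < C /\ graph_search_algorithm (fun n => C * f n) q.
Proof.
move=> [p [a [k pP]]].
(* The program is turned into a total function, whose value is arbitrary where [p] does not halt. *)
pose oracle x := epsilon (inhabits dnil) (fun y => exists t, eval p x y t).
have oracleE x y t : eval p x y t -> oracle x = y.
  move=> pxy; have [t' pxo] : exists t, eval p x (oracle x) t.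
    by apply: (epsilon_spec (inhabits dnil) (fun y => exists t, eval p x y t)); exists y, t.
  exact: (eval_det pxo pxy).
have oracle_cut i : exists2 K : cut i, approx_cut f K & oracle (enc_instance i) = enc_cut K.
  by have [K [t [pK _ Kf]]] := pP i; exists K => //; apply: oracleE pK.
have oracleP : polytime (fun x => exists i, x = enc_instance i) oracle.
  exists p, (fun x => a * dsize x ^ k)%N; split; first by exists a, k.
  move=> _ [i ->]; have [K [t [pK ta _]]] := pP i.
  by exists t; rewrite // (oracleE _ _ _ pK).
have [q [s [[b [j sbj]] qP]]] := polytime_search oracle_cut oracleP.
exists 16, q; split; first by rewrite ltr0n.
exists b, j => i; have [D DE Dapprox] := search_tree_data_enc oracle_cut i.
have iP : exists i', enc_instance i = enc_instance i' by exists i.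
have [t qt ts] := qP _ iP.
by exists D, t; split=> //; [rewrite -DE | apply: leq_trans ts (sbj _ iP)].
Qed.
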